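(* Let $\Phi(t)$ be a continuous (real $2n\times 2n$) symplectic matrix function on $[a,b]$, let $$\mathcal F(\Phi):=\{\Phi(\cdot)C:\ C\in\mathbb R^{2n\times n}\text{ is a Lagrangian plane}\},$$ and let $Y_a,Y_b\in\mathcal F(\Phi)$ be the unique continuous Lagrangian paths given by $Y_a(t)=\Phi(t)\Phi^{-1}(a)E$ and $Y_b(t)=\Phi(t)\Phi^{-1}(b)E$, so that $Y_a(a)=E=Y_b(b)$. Then for any integers $\ell$ and $r$ satisfying $$\mathcal N(Y_a,[a,b])\leq\ell\leq\mathcal N(Y_b,[a,b])\quad\text{and}\quad\mathcal N^*(Y_b,[a,b])\leq r\leq\mathcal N^*(Y_a,[a,b])$$ there exists a continuous Lagrangian path $Y=\begin{pmatrix}X\\ U\end{pmatrix}\in\mathcal F(\Phi)$ such that $$\mathcal N(Y,[a,b])=\ell\quad\text{and}\quad\mathcal N^*(Y,[a,b])=r.$$ Moreover, if $\ell\geq r$, then the Lagrangian path $Y$ can be chosen with $X(a)=I$, and if $\ell\leq r$, then the Lagrangian path $Y$ can be chosen with $X(b)=I$. In particular, when $\ell=r$ the Lagrangian path $Y$ may be chosen with both $X(a)$ and $X(b)$ invertible.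
   Context: Notation. $n\in\mathbb N$, $[a,b]\subseteq\mathbb R$, $\mathcal J=\begin{pmatrix}0&I\\ -I&0\end{pmatrix}\in\mathbb R^{2n\times2n}$, $E=\begin{pmatrix}0\\ I\end{pmatrix}\in\mathbb R^{2n\times n}$. A real $2n\times 2n$ matrix $S$ is symplectic if $S^T\mathcal JS=\mathcal J$. A Lagrangian plane is a constant $Y\in\mathbb R^{2n\times n}$ with $Y^T\mathcal JY=0$ and $\operatorname{rank}Y=n$. A continuous Lagrangian path on $[a,b]$ is a continuous $Y:[a,b]\to\mathbb R^{2n\times n}$ such that every $Y(t)$ is a Lagrangian plane. We write $Y=\begin{pmatrix}X\\ U\end{pmatrix}$ with $n\times n$ blocks (similarly $\hat Y$ with $\hat X,\hat U$). The Wronskian is $W(Y,\hat Y)=Y^T\mathcal J\hat Y$. Comparative index. For Lagrangian planes $Y,\hat Y$ put $\mathcal M=(I-X^\dagger X)W(Y,\hat Y)$, $V=I-\mathcal M^\dagger\mathcal M$, $\mathcal P=V[W(Y,\hat Y)]^TX^\dagger\hat XV$ (a symmetric matrix), where $\dagger$ is the Moore–Penrose pseudoinverse. The comparative index and dual comparative index are $\mu(Y,\hat Y)=\operatorname{rank}\mathcal M+\operatorname{ind}\mathcal P$, $\mu^*(Y,\hat Y)=\operatorname{rank}\mathcal M+\operatorname{ind}(-\mathcal P)$, with $\operatorname{ind}$ the number of negative eigenvalues. Oscillation numbers. For a continuous Lagrangian path $Y$ on $[a,b]$ take a partition $a=t_0<t_1<\dots<t_p=b$ and real symplectic matrix functions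 $R_k(t)$, $k=0,\dots,p-1$, with $R_k$ continuous on $[t_k,t_{k+1}]$ and such that, for each $k$, both $\operatorname{rank}W(R_k(t)E,Y(t))$ and $\operatorname{rank}\big((I\ \,0)R_k(t)E\big)$ are constant for $t\in[t_k,t_{k+1}]$. Then $$\mathcal N(Y,[a,b]):=\sum_{k=0}^{p-1}\big[\mu(Y(t_{k+1}),R_k(t_{k+1})E)-\mu(Y(t_k),R_k(t_k)E)\big],$$ $$\mathcal N^*(Y,[a,b]):=\sum_{k=0}^{p-1}\big[\mu^*(Y(t_k),R_k(t_k)E)-\mu^*(Y(t_{k+1}),R_k(t_{k+1})E)\big].$$ Such partitions and systems exist and the values do not depend on their choice. *)

(* Defs.v *)
From HB Require Import structures.
From mathcomp Require Import all_boot all_order all_algebra.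
From mathcomp Require Import all_classical all_reals all_analysis.
From mathcomp Require Import polyrcf.

Set Implicit Arguments.
Unset Strict Implicit.
Unset Printing Implicit Defensive.

Import Order.TTheory GRing.Theory Num.Theory.
Import numFieldNormedType.Exports.

Local Open Scope classical_set_scope.
Local Open Scope ring_scope.

Section MoorePenrose.
Variable R : realType.

Definition is_mpinv m n (A : 'M[R]_(m, n)) (B : 'M[R]_(n, m)) : Prop :=
  [/\ A *m B *m A = A, B *m A *m B = B,
      (A *m B)^T = A *m B & (B *m A)^T = B *m A].

Definition mpinv m n (A : 'M[R]_(m, n)) : 'M[R]_(n, m) :=
  xget 0 [set B | is_mpinv A B].

Lemma mulmx_trmx_eq0 m n (A : 'M[R]_(m, n)) : A *m A^T = 0 -> A = 0.
Proof.
move=> A0; apply/matrixP => i j; rewrite mxE.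
have /eqP := congr1 (fun B : 'M[R]_m => B i i) A0.
rewrite !mxE psumr_eq0 => [/allP/(_ j)|k _]; last by rewrite mxE -expr2 sqr_ge0.
by rewrite mem_index_enum mxE mulf_eq0 orbb => /(_ isT)/eqP.
Qed.

Lemma row_free_gram m n (A : 'M[R]_(m, n)) :
  row_free A -> A *m A^T \in unitmx.
Proof.
move=> Afree; rewrite -row_free_unit -kermx_eq0; set K := kermx _.
have : K *m A *m (K *m A)^T = 0.
  by rewrite trmx_mul mulmxA -(mulmxA K) mulmx_ker mul0mx.
by move/mulmx_trmx_eq0/eqP; rewrite mulmx_free_eq0.
Qed.

Lemma is_mpinv_exists m n (A : 'M[R]_(m, n)) : exists B, is_mpinv A B.
Proof.
have [r [C [F [AE Cfull Ffree]]]] : exists r (C : 'M[R]_(m, r))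
    (F : 'M[R]_(r, n)), [/\ C *m F = A, row_full C & row_free F].
  exists (\rank A), (col_base A), (row_base A); split.
  - exact: mulmx_base.
  - exact: col_base_full.
  - exact: row_base_free.
have uF : F *m F^T \in unitmx by exact: row_free_gram.
have uC : C^T *m C \in unitmx.
  rewrite -[X in _ *m X]trmxK; apply: row_free_gram.
  by rewrite /row_free mxrank_tr.
pose B := F^T *m invmx (F *m F^T) *m (invmx (C^T *m C) *m C^T).
have FB : F *m B = invmx (C^T *m C) *m C^T.
  by rewrite /B !mulmxA mulmxV // mul1mx.
have BC : B *m C = F^T *m invmx (F *m F^T).
  by rewrite /B -!mulmxA mulVmx // mulmx1.
have AB : A *m B = C *m invmx (C^T *m C) *m C^T.
  by rewrite -AE -mulmxA FB mulmxA.
have BA : B *m A = F^T *m invmx (F *m F^T) *m F by rewrite -AE mulmxA BC.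
exists B; split.
- by rewrite AB -AE -!mulmxA (mulmxA _ C F) (mulmxA (invmx _)) mulVmx // mul1mx.
- rewrite BA /B -!mulmxA (mulmxA F F^T) (mulmxA (F *m F^T)) mulmxV // mul1mx.
  by [].
- by rewrite AB !trmx_mul trmxK trmx_inv trmx_mul trmxK mulmxA.
- by rewrite BA !trmx_mul trmxK trmx_inv trmx_mul trmxK mulmxA.
Qed.

Lemma is_mpinv_unique m n (A : 'M[R]_(m, n)) B C :
  is_mpinv A B -> is_mpinv A C -> B = C.
Proof.
move=> [B1 B2 B3 B4] [C1 C2 C3 C4].
have AB : A *m B = A *m C.
  rewrite -[LHS]B3 -{1}C1 -(mulmxA _ A B) trmx_mul B3 C3.
  by rewrite mulmxA B1.
have BA : B *m A = C *m A.
  rewrite -[LHS]B4 -{1}C1 -!mulmxA (mulmxA B) trmx_mul B4 C4.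
  by rewrite -mulmxA (mulmxA A) B1.
by rewrite -B2 BA -mulmxA AB mulmxA C2.
Qed.

Lemma mpinvP m n (A : 'M[R]_(m, n)) : is_mpinv A (mpinv A).
Proof.
by rewrite /mpinv; case: xgetP => [B _ //|no]; have [B /no] := is_mpinv_exists A.
Qed.

End MoorePenrose.

Section Oscillation.
Variables (R : realType) (n : nat).

Implicit Types (Y Yh : 'M[R]_(n + n, n)) (S : 'M[R]_(n + n)) (P : 'M[R]_n).

Definition Jmx : 'M[R]_(n + n) := block_mx 0 1%:M (- 1%:M) 0.

Definition Emx : 'M[R]_(n + n, n) := col_mx 0 1%:M.

Definition symplectic S : Prop := S^T *m Jmx *m S = Jmx.

Definition lagrangian_plane Y : Prop :=
  Y^T *m Jmx *m Y = 0 /\ \rank Y = n.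

Definition wronskian Y Yh : 'M[R]_n := Y^T *m Jmx *m Yh.

(* negative eigenvalues are counted with (algebraic) multiplicity *)
Definition ind P : nat :=
  (\sum_(x <- rootsR (char_poly P) | (x < 0)%R) mup x (char_poly P))%N.

Definition cind_M Y Yh : 'M[R]_n :=
  (1%:M - mpinv (usubmx Y) *m usubmx Y) *m wronskian Y Yh.

Definition cind_V Y Yh : 'M[R]_n :=
  1%:M - mpinv (cind_M Y Yh) *m cind_M Y Yh.

Definition cind_P Y Yh : 'M[R]_n :=
  cind_V Y Yh *m (wronskian Y Yh)^T *m mpinv (usubmx Y) *m usubmx Yh
    *m cind_V Y Yh.

Definition cind Y Yh : nat := (\rank (cind_M Y Yh) + ind (cind_P Y Yh))%N.

Definition dual_cind Y Yh : nat :=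
  (\rank (cind_M Y Yh) + ind (- cind_P Y Yh))%N.

Definition lagrangian_path (a b : R) (Y : R -> 'M[R]_(n + n, n)) : Prop :=
  {within `[a, b], continuous Y} /\
  (forall s, s \in `[a, b] -> lagrangian_plane (Y s)).

(* Only t 0, ..., t p and T 0, ..., T p.-1 (on the respective subintervals)
   are relevant. *)
Definition adapted_system (a b : R) (Y : R -> 'M[R]_(n + n, n))
    (p : nat) (t : nat -> R) (T : nat -> R -> 'M[R]_(n + n)) : Prop :=
  [/\ t 0 = a, t p = b &
    forall k, (k < p)%N ->
      [/\ t k < t k.+1,
          {within `[t k, t k.+1], continuous (T k)},
          forall s, s \in `[t k, t k.+1] -> symplectic (T k s),
          {in `[t k, t k.+1] &, forall s s',
            \rank (wronskian (T k s *m Emx) (Y s)) =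
            \rank (wronskian (T k s' *m Emx) (Y s'))} &
          {in `[t k, t k.+1] &, forall s s',
            \rank (usubmx (T k s *m Emx)) = \rank (usubmx (T k s' *m Emx))}]].

Definition osc_sum (Y : R -> 'M[R]_(n + n, n))
    (p : nat) (t : nat -> R) (T : nat -> R -> 'M[R]_(n + n)) : int :=
  \sum_(k < p) ((cind (Y (t k.+1)) (T k (t k.+1) *m Emx))%:Z
                - (cind (Y (t k)) (T k (t k) *m Emx))%:Z).

Definition dual_osc_sum (Y : R -> 'M[R]_(n + n, n))
    (p : nat) (t : nat -> R) (T : nat -> R -> 'M[R]_(n + n)) : int :=
  \sum_(k < p) ((dual_cind (Y (t k)) (T k (t k) *m Emx))%:Z
                - (dual_cind (Y (t k.+1)) (T k (t k.+1) *m Emx))%:Z).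

(* For a continuous Lagrangian path, adapted systems exist and the sums below
   do not depend on them; outside that case the value is irrelevant. *)
Definition osc (Y : R -> 'M[R]_(n + n, n)) (a b : R) : int :=
  xget 0 [set z | exists p t T,
            adapted_system a b Y p t T /\ z = osc_sum Y p t T].

Definition dual_osc (Y : R -> 'M[R]_(n + n, n)) (a b : R) : int :=
  xget 0 [set z | exists p t T,
            adapted_system a b Y p t T /\ z = dual_osc_sum Y p t T].

(* Paths are total functions R -> 'M_(n + n, n); only their values on `[a, b]
   matter. *)
Definition sol_family (a b : R) (Phi : R -> 'M[R]_(n + n)) :
    set (R -> 'M[R]_(n + n, n)) :=
  [set Y | exists2 C, lagrangian_plane C &
             forall s, s \in `[a, b] -> Y s = Phi s *m C].

Definition sol_at (Phi : R -> 'M[R]_(n + n)) (c s : R) : 'M[R]_(n + n, n) :=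
  Phi s *m invmx (Phi c) *m Emx.

End Oscillation.

Arguments Jmx {R n}.
Arguments Emx {R n}.

(* Main.v *)
(* With respect to a real number lam such that K = U - lam X is invertible, a
   Lagrangian plane Y = (X; U) is described by the symmetric matrix
   Q(Y) = X K^-1, its slope. Decomposing a 2 x 2 block form in two ways gives
     mu(Y, Yh)  = ind (Q Y - Q Yh) + ind (Q Yh) - ind (Q Y),
     mu*(Y, Yh) = ind (Q Yh - Q Y) + ind (- Q Yh) - ind (- Q Y),
   with rank Q(Y) = rank X and rank (Q Y - Q Yh) = rank W(Y, Yh). The index of
   a continuous symmetric matrix of constant rank is locally constant, so for
   two paths with W(Y, Yh) of constant rank,
   mu(Y, R E) - mu(Yh, Rh E) - mu(Y, Yh) is constant on every interval where R
   and Rh are adapted to Y and Yh. Hence, whatever the systems chosen,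
     N(Y) - N(Yh) = mu(Y(b), Yh(b)) - mu(Y(a), Yh(a)), and dually for N*;
   with Yh = Y this is the independence of the choice. Comparing with Y_a, whose
   value at b is F, the theorem becomes: given 0 <= m, k <= rank Q(F), find a
   plane L with mu(L, F) = m and mu*(L, F) = k, transversal to F if
   m + k >= rank Q(F) and to E if m + k <= rank Q(F); diagonalizing Q(F), the
   slope of L can be chosen one coordinate at a time. *)

Require Import Defs.
From HB Require Import structures.
From mathcomp Require Import all_boot all_order all_algebra.
From mathcomp Require Import all_classical all_reals all_analysis.
From mathcomp Require Import polyrcf complex zify.
From mathcomp Require Import ring lra.

Set Implicit Arguments.
Unset Strict Implicit.
Unset Printing Implicit Defensive.

Import Order.TTheory GRing.Theory Num.Theory.
Import numFieldNormedType.Exports.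

Local Open Scope classical_set_scope.
Local Open Scope ring_scope.

(** * Real symmetric matrices and their index *)

Section SymmetricMatrices.
Variable R : realType.

Lemma trmxZ m n (c : R) (A : 'M[R]_(m, n)) : (c *: A)^T = c *: A^T.
Proof. exact: linearZ. Qed.

Lemma trmxN m n (A : 'M[R]_(m, n)) : (- A)^T = - A^T.
Proof. exact: raddfN. Qed.

Lemma trmxD m n (A B : 'M[R]_(m, n)) : (A + B)^T = A^T + B^T.
Proof. exact: raddfD. Qed.

Lemma trmxB m n (A B : 'M[R]_(m, n)) : (A - B)^T = A^T - B^T.
Proof. exact: raddfB. Qed.

(** Over the complex numbers an eigenvector [v] exists. Pairing it with its conjugate [w] in two
    ways gives that the eigenvalue minus its conjugate annihilates [w v^T], a positive number, so
    the eigenvalue is real. *)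
Lemma sym_eigenvalue n (P : 'M[R]_n.+1) : P^T = P -> exists x, eigenvalue P x.
Proof.
move=> Psym.
have [[x y] /eigenvalueP[v vP v0]] :=
  Theorem7' (map_mx (real_complex R) P) (ltn0Sn n).
pose w := map_mx conjc v.
have wP : w *m map_mx (real_complex R) P = conjc (x +i* y)%C *: w.
  rewrite -map_mxZ -vP map_mxM; congr (_ *m _).
  by apply/matrixP => i j; rewrite !mxE /= oppr0.
have vw : ((x +i* y)%C - conjc (x +i* y)%C) *: (w *m v^T) = 0.
  rewrite scalerBl scalemxAr -[(x +i* y)%C *: v^T]linearZ /= -vP trmx_mul.
  by rewrite map_trmx Psym mulmxA wP -scalemxAl subrr.
have vw0 : (w *m v^T) 0 0 != 0.
  apply: contraNneq v0 => /eqP; rewrite mxE psumr_eq0 => [/allP v0|i _]; last first.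
    by rewrite !mxE mulrC mulcJ_ge0.
  apply/eqP/rowP => i; have := v0 i; rewrite mem_index_enum !mxE mulf_eq0.
  by rewrite conjc_eq0 orbb => /(_ isT)/eqP.
have /eqP := congr1 (fun A : 'M[R[i]]_1 => A 0 0) vw.
rewrite mxE [X in _ == X]mxE mulf_eq0 (negbTE vw0) orbF => /eqP /(congr1 (@complex.Im R)) /= yy.
have y0 : y = 0 by lra.
exists x; rewrite -(eigenvalue_map (real_complex R)); apply/eigenvalueP.
by exists v => //; rewrite vP y0.
Qed.

Lemma mulmx_trmx_rowE n (v : 'rV[R]_n) : v *m v^T = (\sum_j v 0 j ^+ 2)%:M.
Proof. by rewrite [LHS]mx11_scalar mxE; under eq_bigr do rewrite mxE -expr2. Qed.

Lemma sqr_sum_gt0 n (v : 'rV[R]_n) : v != 0 -> 0 < \sum_j v 0 j ^+ 2.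
Proof.
move=> v0; rewrite lt_neqAle sumr_ge0 ?andbT => [|i _]; last exact: sqr_ge0.
apply: contraNneq v0 => c0; apply/eqP/mulmx_trmx_eq0.
by rewrite mulmx_trmx_rowE -c0 raddf0.
Qed.

(* Householder reflection exchanging [v] and the first basis vector. *)
Lemma orthogonal_completion n (v : 'rV[R]_n.+1) : v *m v^T = 1%:M ->
  exists2 H : 'M[R]_n.+1, H *m H^T = 1%:M & delta_mx 0 0 *m H = v.
Proof.
move=> v1; set e : 'rV[R]_n.+1 := delta_mx 0 0.
have e1 : e *m e^T = 1%:M.
  rewrite mulmx_trmx_rowE (bigD1 0) //= big1 ?addr0 => [|j /negPf j0].
    by rewrite mxE !eqxx expr1n.
  by rewrite mxE j0 andbF expr0n.
have [<-|ev] := eqVneq e v; first by exists 1%:M; rewrite ?trmx1 ?mulmx1.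
pose w := e - v; pose c := \sum_j w 0 j ^+ 2.
have wc : w *m w^T = c%:M by rewrite mulmx_trmx_rowE.
have c0 : c != 0.
  apply: contraNneq ev => c0; rewrite -subr_eq0; apply/eqP.
  by apply: mulmx_trmx_eq0; rewrite wc c0 raddf0.
have ve : v *m e^T = e *m v^T.
  have -> : v *m e^T = (e *m v^T)^T by rewrite trmx_mul trmxK.
  by rewrite [e *m v^T]mx11_scalar tr_scalar_mx.
have ew : e *m w^T = (c / 2)%:M.
  suff : w *m w^T = 2 *: (e *m w^T).
    rewrite wc => /(congr1 (fun A => 2^-1 *: A)).
    by rewrite scalerA mulVf ?pnatr_eq0// scale1r => <-; rewrite scale_scalar_mx mulrC.
  rewrite /w linearB /= mulmxBl !mulmxBr e1 v1 ve.
  by rewrite opprB scaler_nat mulr2n.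
pose G := w^T *m w.
have Gsym : G^T = G by rewrite trmx_mul trmxK.
have GG : G *m G = c *: G.
  by rewrite /G mulmxA -(mulmxA w^T) wc mul_mx_scalar -scalemxAl.
exists (1%:M - (2 / c) *: G).
  rewrite raddfB /= trmx1 trmxZ Gsym mulmxBl mul1mx mulmxBr mulmx1.
  rewrite -scalemxAl -scalemxAr GG !scalerA.
  by apply/matrixP => i j; rewrite !mxE; field.
rewrite mulmxBr mulmx1 -scalemxAr mulmxA ew mul_scalar_mx scalerA.
by rewrite mulrA divfK // divff ?pnatr_eq0// scale1r /w opprB addrC subrK.
Qed.

(** Induction on the size: an orthogonal matrix takes a unit eigenvector to the first basis vector.
    By symmetry the first row and column then vanish off the diagonal, and the induction hypothesis
    handles the remaining block. *)
Lemma sym_orthogonal_diag n (P : 'M[R]_n) : P^T = P ->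
  exists (O : 'M[R]_n) (d : 'rV[R]_n),
    O *m O^T = 1%:M /\ P = O^T *m diag_mx d *m O.
Proof.
elim: n P => [|n IH] P Psym.
  by exists 1%:M, 0; split; apply/matrixP => -[].
have [x /eigenvalueP[u uP u0]] := sym_eigenvalue Psym.
pose c := \sum_j u 0 j ^+ 2.
have c_gt0 : 0 < c by exact: sqr_sum_gt0.
pose v := (Num.sqrt c)^-1 *: u.
have vP : v *m P = x *: v by rewrite -scalemxAl uP !scalerA mulrC.
have v1 : v *m v^T = 1%:M.
  rewrite /v linearZ /= -scalemxAl -scalemxAr mulmx_trmx_rowE -/c scalerA.
  rewrite -invfM -expr2 sqr_sqrtr ?ltW // scale_scalar_mx mulVf //.
  by rewrite gt_eqF.
have [H HH eH] := orthogonal_completion v1.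
have HtH : H^T *m H = 1%:M by apply: mulmx1C.
pose Q : 'M[R]_(1 + n) := H *m P *m H^T.
have Qsym : Q^T = Q by rewrite /Q !trmx_mul trmxK Psym mulmxA.
(* The first basis vector is an eigenvector of [Q], which determines the whole first row. *)
have Q0 : usubmx Q = row_mx x%:M 0.
  apply/rowP => j; have : (delta_mx 0 0 : 'rV_n.+1) *m Q = x *: delta_mx 0 0.
    by rewrite /Q !mulmxA eH vP -eH -scalemxAl -mulmxA HH mulmx1.
  rewrite -rowE => /rowP/(_ j); rewrite !mxE.
  have -> : lshift n (0 : 'I_1) = 0 by apply/val_inj.
  move=> ->; case: split_ordP => k ->; rewrite !mxE //=.
    by rewrite ord1 -val_eqE /= mulr1.
  by rewrite mulr0.
have [|O [d [OO Pd]]] := IH (drsubmx Q).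
  by rewrite -{2}Qsym -trmx_drsub.
have QE : Q = block_mx x%:M 0 0 (drsubmx Q).
  rewrite -[LHS]submxK /ulsubmx /ursubmx Q0 row_mxKl row_mxKr.
  congr block_mx; rewrite -{1}Qsym -trmx_ursub /ursubmx Q0 row_mxKr trmx0 //.
pose B : 'M[R]_(1 + n) := block_mx 1%:M 0 0 O.
have BB : B *m B^T = 1%:M.
  rewrite tr_block_mx mulmx_block.
  by rewrite !trmx0 trmx1 !mulmx0 !mul0mx !mulmx1 OO !addr0 add0r -scalar_mx_block.
have QB : Q = B^T *m diag_mx (row_mx x%:M d) *m B.
  rewrite {1}QE {1}Pd diag_mx_row tr_block_mx !mulmx_block !trmx0 trmx1.
  rewrite !(mulmx0, mul0mx, mulmx1, mul1mx, addr0, add0r).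
  by congr block_mx; apply/matrixP => i j; rewrite !mxE !ord1.
exists (B *m H), (row_mx x%:M d); split.
  by rewrite trmx_mul mulmxA -(mulmxA _ H) HH mulmx1.
have -> : P = H^T *m Q *m H.
  by rewrite /Q !mulmxA HtH mul1mx -mulmxA HtH mulmx1.
by rewrite trmx_mul {1}QB !mulmxA.
Qed.

(** This leaves the definition of [ind] by roots behind: orthogonally similar matrices share their
    characteristic polynomial, here the product of the [X - d_i], so multiplicities become counts of
    diagonal entries. *)
Lemma ind_orthogonal_diag n (O : 'M[R]_n) (d : 'rV[R]_n) : O *m O^T = 1%:M ->
  ind (O^T *m diag_mx d *m O) = #|[pred i | d 0 i < 0]|.
Proof.
move=> OO; have OtO : O^T *m O = 1%:M by apply: mulmx1C.
pose s := [seq d 0 i | i <- enum 'I_n].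
have charE : char_poly (O^T *m diag_mx d *m O) = \prod_(y <- s) ('X - y%:P).
  have -> : char_poly (O^T *m diag_mx d *m O) = char_poly (diag_mx d).
    rewrite /char_poly; set Q := diag_mx d.
    have -> : char_poly_mx (O^T *m Q *m O) =
        map_mx polyC O^T *m char_poly_mx Q *m map_mx polyC O.
      rewrite /char_poly_mx !map_mxM mulmxBr mulmxBl; congr (_ - _).
      by rewrite mul_mx_scalar -scalemxAl -map_mxM OtO map_mx1 scalemx1.
    by rewrite !det_mulmx mulrAC -det_mulmx -map_mxM OtO map_mx1 det1 mul1r.
  rewrite char_poly_trig ?diag_mx_is_trig // big_map big_enum.
  by apply: eq_bigr => i _; rewrite mxE eqxx.
have s_neq0 : \prod_(y <- s) ('X - y%:P) != 0.
  by rewrite monic_neq0 // monic_prod_XsubC.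
rewrite /ind charE; under eq_bigr do rewrite mu_prod_XsubC.
have sub : {subset s <= rootsR (\prod_(y <- s) ('X - y%:P))}.
  by move=> y ys; rewrite -(roots_on_rootsR s_neq0) root_prod_XsubC ys in_itv.
have -> : #|[pred i | d 0 i < 0]| = count (fun y => y < 0) s.
  rewrite count_map -sum1_count -sum1_card big_enum_cond /=.
  by apply: eq_bigl => i; rewrite inE.
have : uniq (rootsR (\prod_(y <- s) ('X - y%:P))) by exact: uniq_roots.
(* After generalization to any duplicate-free [r] containing [s], each element of [s] contributes to
   exactly one term of the sum over [r]. *)
move: sub; move: (rootsR _) => r.
elim: s {charE s_neq0} => [_ _|y s IH sub ur] /=; first by rewrite big1.
rewrite big_split /= {}IH //; last by move=> z zs; rewrite sub // inE zs orbT.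
congr (_ + _)%N; have yr : y \in r by rewrite sub // mem_head.
rewrite big_mkcond (bigD1_seq y) //= [X in (_ + X)%N]big1 => [|z /negPf zy].
  by rewrite eqxx addn0; case: (y < 0).
by rewrite eq_sym zy if_same.
Qed.

Lemma mul_rowsub1T k n (f : 'I_k -> 'I_n) : injective f ->
  rowsub f 1%:M *m (rowsub f 1%:M)^T = 1%:M :> 'M[R]_k.
Proof.
move=> finj; rewrite mul_rowsub_mx mul1mx; apply/matrixP => i j.
by rewrite !mxE (inj_eq finj) eq_sym.
Qed.

Lemma rank_rowsub1 k n (f : 'I_k -> 'I_n) : injective f ->
  \rank (rowsub f 1%:M : 'M[R]_(k, n)) = k.
Proof.
move=> finj; apply/eqP; rewrite eqn_leq rank_leq_row /=.
by rewrite -{1}(mxrank1 R k) -(mul_rowsub1T finj) mxrankM_maxl.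
Qed.

Lemma rowsub1_diag k n (f : 'I_k -> 'I_n) (d : 'rV[R]_n) : injective f ->
  rowsub f 1%:M *m diag_mx d *m (rowsub f 1%:M)^T =
  diag_mx (\row_i d 0 (f i)).
Proof.
move=> finj; rewrite mul_rowsub_mx mul1mx; apply/matrixP => i j.
rewrite !mxE (bigD1 (f i)) //= big1 ?addr0 => [|l /negPf lf].
  by rewrite !mxE eqxx (inj_eq finj) [j == i]eq_sym mulr_natr.
by rewrite !mxE eq_sym lf mulr0n mul0r.
Qed.

(** The rows selecting zero entries annihilate the matrix, which bounds the rank above; compression
    to the nonzero entries is invertible, which bounds it below. *)
Lemma rank_diag_mx n (d : 'rV[R]_n) :
  \rank (diag_mx d) = #|[pred i | d 0 i != 0]|.
Proof.
set A := [pred i | _]; apply/eqP; rewrite eqn_leq; apply/andP; split.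
  pose S : 'M[R]_(_, n) := rowsub (enum_val : 'I_#|[predC A]| -> 'I_n) 1%:M.
  have : (\rank S + \rank (diag_mx d) <= n)%N.
    apply: mulmx0_rank_max; rewrite mul_rowsub_mx mul1mx; apply/matrixP => i j.
    rewrite !mxE; have := enum_valP i; rewrite !inE negbK => /eqP ->.
    by rewrite mul0rn.
  rewrite rank_rowsub1; last exact: enum_val_inj.
  by rewrite -[X in (_ <= X)%N]card_ord -(cardC A) addnC leq_add2r.
have <- : \rank (diag_mx (\row_i d 0 (enum_val (i : 'I_#|A|)))) = #|A|.
  apply: mxrank_unit; rewrite unitmxE det_diag unitfE; apply/prodf_neq0 => i _.
  by rewrite mxE; have := enum_valP i; rewrite inE.
rewrite -rowsub1_diag; last exact: enum_val_inj.
by rewrite (leq_trans (mxrankM_maxl _ _)) // mxrankM_maxr.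
Qed.

(** The rows of [N] are eigenvectors for the negative eigenvalues, each divided by the square root
    of the absolute value of its eigenvalue. With [ind_max] this makes the index the largest size of
    such an [N], the form in which it is used below. *)
Lemma ind_witness n (P : 'M[R]_n) : P^T = P ->
  exists N : 'M[R]_(ind P, n), N *m P *m N^T = - 1%:M.
Proof.
move=> /sym_orthogonal_diag [ O [d [OO ->]]]; rewrite ind_orthogonal_diag //.
set A := [pred i | _]; pose f : 'I_#|A| -> 'I_n := enum_val.
have finj : injective f by exact: enum_val_inj.
pose c := diag_mx (\row_i (Num.sqrt (- d 0 (f i)))^-1).
exists (c *m (rowsub f 1%:M *m O)).
rewrite !trmx_mul !mulmxA -(mulmxA _ O) OO mulmx1 -(mulmxA _ O O^T) OO mulmx1.
rewrite -[c *m _ *m _]mulmxA -[c *m _ *m _]mulmxA rowsub1_diag //.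
rewrite mulmx_diag tr_diag_mx mulmx_diag.
rewrite -[RHS]scaleN1r -[1%:M]/(scalar_mx 1) scale_scalar_mx mulr1.
rewrite -diag_const_mx; congr diag_mx; apply/rowP => i; rewrite !mxE.
have di : 0 < - d 0 (f i) by have := enum_valP i; rewrite inE oppr_gt0.
rewrite mulrAC -invfM -expr2 sqr_sqrtr ?ltW // -[X in _ * X]opprK mulrN mulVf //.
by rewrite gt_eqF.
Qed.

(** Dimension count: if [k] exceeded the number of negative eigenvalues, some nonzero combination of
    the rows of [N] would be orthogonal to all their eigenvectors, and the form would be nonnegative
    on it. *)
Lemma ind_max_negdef n k (P : 'M[R]_n) (N : 'M[R]_(k, n)) : P^T = P ->
  (forall v : 'rV_k, v != 0 -> (v *m (N *m P *m N^T) *m v^T) 0 0 < 0) ->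
  (k <= ind P)%N.
Proof.
move=> /sym_orthogonal_diag [ O [d [OO ->]]]; rewrite ind_orthogonal_diag //.
set A := [pred i | _]; pose f : 'I_#|A| -> 'I_n := enum_val => NPN.
rewrite leqNgt; apply/negP => kA.
pose C := N *m O^T *m (rowsub f 1%:M)^T.
have : kermx C != 0.
  by rewrite kermx_eq0 -row_leq_rank -ltnNge (leq_ltn_trans (rank_leq_col _)).
move=> /rowV0Pn[v /sub_kermxP vC v0].
pose w := v *m N *m O^T.
have w0 i : d 0 i < 0 -> w 0 i = 0.
  move=> di; have iA : i \in A by rewrite inE.
  have /rowP/(_ (enum_rank_in iA i)) : w *m (rowsub f 1%:M)^T = 0.
    by rewrite -vC /C !mulmxA.
  rewrite !mxE (bigD1 i) //= big1 ?addr0 => [|j /negPf ji].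
    by rewrite !mxE /f enum_rankK_in // eqxx mulr1.
  by rewrite !mxE /f enum_rankK_in // eq_sym ji mulr0.
have := NPN v v0; apply/negP; rewrite -leNgt.
have -> : v *m (N *m (O^T *m diag_mx d *m O) *m N^T) *m v^T = w *m diag_mx d *m w^T.
  by rewrite /w !trmx_mul trmxK !mulmxA.
rewrite mxE; apply: sumr_ge0 => i _.
rewrite mul_mx_diag [X in X * _]mxE [X in _ * X]mxE mulrAC -expr2.
have [di|di] := ltP (d 0 i) 0; first by rewrite w0 // expr0n mul0r.
by rewrite mulr_ge0 ?sqr_ge0.
Qed.

Lemma ind_max n k (P : 'M[R]_n) (N : 'M[R]_(k, n)) : P^T = P ->
  N *m P *m N^T = - 1%:M -> (k <= ind P)%N.
Proof.
move=> Psym NPN; apply: (ind_max_negdef (N := N)) => // v v0.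
rewrite NPN mulmxN mulmx1 mulNmx mulmx_trmx_rowE !mxE eqxx mulr1n oppr_lt0.
exact: sqr_sum_gt0.
Qed.

(** This is the device that turns inequalities into equalities: lower or upper bounds for [P] and
    [- P] together are sharp once the rank is known. *)
Lemma ind_add_opp n (P : 'M[R]_n) : P^T = P -> (ind P + ind (- P) = \rank P)%N.
Proof.
move=> /sym_orthogonal_diag [ O [d [OO ->]]].
have OtO : O^T *m O = 1%:M by apply: mulmx1C.
have -> : - (O^T *m diag_mx d *m O) = O^T *m diag_mx (- d) *m O.
  by rewrite raddfN /= mulmxN mulNmx.
have [uO _] := mulmx1_unit OO.
rewrite !ind_orthogonal_diag // mxrankMfree ?row_free_unit //.
rewrite eqmxMfull ?row_full_unit ?unitmx_tr // rank_diag_mx.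
rewrite -cardUI [X in (_ + X)%N]eq_card0 ?addn0.
  by apply: eq_card => i; rewrite !inE !mxE oppr_lt0 neq_lt.
by move=> i; rewrite !inE !mxE oppr_lt0; case: ltgtP.
Qed.

End SymmetricMatrices.

(** * Calculus of the index *)

Section IndexCalculus.
Variable R : realType.

Lemma sym_mulmx_tr_eq0 m n (P : 'M[R]_n) (M : 'M[R]_(m, n)) :
  P^T = P -> M *m P = 0 -> P *m M^T = 0.
Proof. by move=> Psym MP; rewrite -[P]Psym -trmx_mul MP trmx0. Qed.

Lemma ind_le_congr m n (P : 'M[R]_m) (Q : 'M[R]_n) (G : 'M[R]_(m, n)) :
  Q^T = Q -> P = G *m Q *m G^T -> (ind P <= ind Q)%N.
Proof.
move=> Qsym PE; have Psym : P^T = P by rewrite PE !trmx_mul trmxK Qsym mulmxA.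
have [N NPN] := ind_witness Psym.
by apply: (@ind_max _ _ _ _ (N *m G)) => //; rewrite -NPN [X in _ = _ *m X *m _]PE trmx_mul !mulmxA.
Qed.

(** [G] may be rectangular. The index inequality holds for both signs, and the rank hypothesis
    leaves no room for a strict one. *)
Lemma ind_congr_rank m n (P : 'M[R]_m) (Q : 'M[R]_n) (G : 'M[R]_(m, n)) :
  Q^T = Q -> P = G *m Q *m G^T -> (\rank Q <= \rank P)%N -> ind P = ind Q.
Proof.
move=> Qsym PE; have Psym : P^T = P by rewrite PE !trmx_mul trmxK Qsym mulmxA.
have le1 := ind_le_congr Qsym PE.
have : (ind (- P) <= ind (- Q))%N.
  apply: (@ind_le_congr _ _ _ _ G); first by rewrite raddfN /= Qsym.
  by rewrite PE mulmxN mulNmx.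
by have := ind_add_opp Psym; have := ind_add_opp Qsym; lia.
Qed.

Lemma ind_congr n (Q G : 'M[R]_n) :
  Q^T = Q -> G \in unitmx -> ind (G *m Q *m G^T) = ind Q.
Proof.
move=> Qsym uG; apply: (ind_congr_rank Qsym erefl).
rewrite mxrankMfree ?row_free_unit ?unitmx_tr //.
by rewrite eqmxMfull ?row_full_unit.
Qed.

Lemma ind0 n : ind (0 : 'M[R]_n) = 0%N.
Proof.
have := ind_add_opp (trmx0 R n n); rewrite mxrank0 => /eqP.
by rewrite addn_eq0 => /andP[/eqP].
Qed.

Lemma sym_mpinv_range n (P : 'M[R]_n) : P^T = P -> P *m P *m mpinv P = P.
Proof.
move=> Psym; have [P1 _ P3 _] := mpinvP P.
by rewrite -mulmxA -{1}Psym -P3 -trmx_mul P1 Psym.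
Qed.

(** A witness for one summand, multiplied by the orthogonal projection onto the range of that
    summand, is still a witness and is annihilated by the other summand. Hence the two witnesses can
    be stacked. *)
Lemma ind_add_orth_le n (P Q : 'M[R]_n) : P^T = P -> Q^T = Q -> P *m Q = 0 ->
  (ind P + ind Q <= ind (P + Q)%R)%N.
Proof.
move=> Psym Qsym PQ.
have QP : Q *m P = 0 by rewrite -Psym; apply: sym_mulmx_tr_eq0.
have range (S T : 'M[R]_n) : S^T = S -> T^T = T -> S *m T = 0 ->
    exists k (N : 'M[R]_(k, n)),
      [/\ k = ind S, N *m S *m N^T = - 1%:M & N *m T = 0].
  move=> Ssym Tsym ST; have [N NSN] := ind_witness Ssym.
  have [_ _ S3 _] := mpinvP S; have SS := sym_mpinv_range Ssym.
  have TS : T *m S = 0 by rewrite -Ssym -Tsym -trmx_mul ST trmx0.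
  exists (ind S), (N *m (S *m mpinv S)); split => //.
    rewrite trmx_mul S3 -NSN -!mulmxA; congr (_ *m _).
    rewrite !mulmxA; congr (_ *m _); rewrite -!mulmxA; move: SS; rewrite -mulmxA => ->.
    by rewrite mulmxA; case: (mpinvP S).
  by rewrite -mulmxA -S3 -{1}Tsym -trmx_mul mulmxA TS mul0mx trmx0 mulmx0.
have [k [N [<- NP NQ]]] := range P Q Psym Qsym PQ.
have [l [M [<- MQ MP]]] := range Q P Qsym Psym QP.
apply: (@ind_max _ _ _ _ (col_mx N M)); first by rewrite raddfD /= Psym Qsym.
rewrite tr_col_mx mulmxDr !mul_col_mx NQ MP.
rewrite add_col_mx addr0 add0r mul_col_row NP MQ.
have -> : N *m P *m M^T = 0.
  by rewrite -mulmxA sym_mulmx_tr_eq0 // mulmx0.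
have -> : M *m Q *m N^T = 0.
  by rewrite -mulmxA sym_mulmx_tr_eq0 // mulmx0.
by rewrite (scalar_mx_block _ _ 1) opp_block_mx !oppr0.
Qed.

(** Superadditivity for both signs, against subadditivity of the rank. *)
Lemma ind_add_orth n (P Q : 'M[R]_n) : P^T = P -> Q^T = Q -> P *m Q = 0 ->
  ind (P + Q) = (ind P + ind Q)%N.
Proof.
move=> Psym Qsym PQ.
have PQsym : (P + Q)^T = P + Q by rewrite raddfD /= Psym Qsym.
have le1 := ind_add_orth_le Psym Qsym PQ.
have : (ind (- P) + ind (- Q) <= ind (- (P + Q)))%N.
  rewrite opprD; apply: ind_add_orth_le; last by rewrite mulmxN mulNmx PQ !oppr0.
    by rewrite raddfN /= Psym.
  by rewrite raddfN /= Qsym.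
have := mxrank_add P Q; have := ind_add_opp PQsym.
have := ind_add_opp Psym; have := ind_add_opp Qsym; move: le1.
by move: (P + Q) => S; lia.
Qed.

Lemma ind_block_ul m n (P : 'M[R]_m) : P^T = P ->
  ind (block_mx P 0 0 (0 : 'M[R]_n)) = ind P.
Proof.
move=> Psym; apply: (@ind_congr_rank _ _ _ _ (col_mx 1%:M 0)) => //.
  rewrite tr_col_mx mul_col_mx mul_col_row trmx1 trmx0.
  by rewrite !(mul1mx, mul0mx, mulmx1, mulmx0).
by rewrite rank_diag_block_mx mxrank0 addn0.
Qed.

Lemma ind_block_dr m n (P : 'M[R]_n) : P^T = P ->
  ind (block_mx (0 : 'M[R]_m) 0 0 P) = ind P.
Proof.
move=> Psym; apply: (@ind_congr_rank _ _ _ _ (col_mx 0 1%:M)) => //.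
  rewrite tr_col_mx mul_col_mx mul_col_row trmx1 trmx0.
  by rewrite !(mul1mx, mul0mx, mulmx1, mulmx0).
by rewrite rank_diag_block_mx mxrank0.
Qed.

Lemma ind_block_diag m n (P : 'M[R]_m) (Q : 'M[R]_n) : P^T = P -> Q^T = Q ->
  ind (block_mx P 0 0 Q) = (ind P + ind Q)%N.
Proof.
move=> Psym Qsym.
have -> : block_mx P 0 0 Q = block_mx P 0 0 0 + block_mx 0 0 0 Q.
  by rewrite add_block_mx !addr0 !add0r.
rewrite ind_add_orth ?ind_block_ul ?ind_block_dr //.
- by rewrite tr_block_mx Psym !trmx0.
- by rewrite tr_block_mx Qsym !trmx0.
- by rewrite mulmx_block !(mul0mx, mulmx0, addr0) block_mx0.
Qed.

(** Changing the sign of the second block is a congruence from [H] to [- H], so both have the same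
    index, which is half the rank of [H]. *)
Lemma ind_hyperbolic m n (M : 'M[R]_(m, n)) :
  ind (block_mx 0 M M^T 0) = \rank M.
Proof.
set H := block_mx _ _ _ _.
have Hsym : H^T = H by rewrite tr_block_mx trmxK !trmx0.
have rkH : \rank H = (\rank M + \rank M)%N.
  have -> : H = block_mx M 0 0 M^T *m block_mx 0 1%:M 1%:M 0.
    by rewrite mulmx_block !(mul0mx, mulmx0, mulmx1, addr0, add0r).
  rewrite mxrankMfree ?rank_diag_block_mx ?mxrank_tr //.
  apply/row_freeP; exists (block_mx 0 1%:M 1%:M 0).
  by rewrite mulmx_block !(mul0mx, mulmx0, mulmx1, addr0, add0r) -scalar_mx_block.
pose D : 'M[R]_(m + n) := block_mx 1%:M 0 0 (- 1%:M).
have DtD : D^T = D by rewrite tr_block_mx !trmx0 raddfN /= !trmx1.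
have uD : D \in unitmx.
  apply: (proj1 (@mulmx1_unit _ _ D D _)).
  rewrite mulmx_block !(mul0mx, mulmx0, mulmx1, addr0, add0r) mulmxN mulmx1 opprK.
  by rewrite -scalar_mx_block.
have := ind_add_opp Hsym; have -> : - H = D *m H *m D^T.
  rewrite DtD !mulmx_block !(mul0mx, mulmx0, mulmx1, mul1mx, addr0, add0r).
  by rewrite mulmxN mulmx1 mulNmx mul1mx opp_block_mx !oppr0.
by rewrite ind_congr // rkH; lia.
Qed.

(* Off-diagonal entries of [C] with respect to [ker M (+) im M^T] are removed
   by a congruence that leaves [A] and [M] alone; the remaining three pieces
   [A], [M], [V C V] are mutually orthogonal. *)
Lemma ind_bordered m n (A : 'M[R]_m) (M : 'M[R]_(m, n)) (C : 'M[R]_n) :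
  A^T = A -> C^T = C -> A *m M = 0 ->
  let V := 1%:M - mpinv M *m M in
  ind (block_mx A M M^T C) = (ind A + \rank M + ind (V *m C *m V))%N.
Proof.
move=> Asym Csym AM V; have [M1 M2 M3 M4] := mpinvP M; set N := mpinv M in M1 M2 M3 M4 V *.
have Vsym : V^T = V by rewrite /V raddfB /= trmx1 M4.
have MV : M *m V = 0 by rewrite /V mulmxBr mulmx1 mulmxA M1 subrr.
have NA : N *m A = 0.
  have -> : N = N *m (M *m N)^T by rewrite M3 mulmxA M2.
  by rewrite -mulmxA trmx_mul -mulmxA -Asym -trmx_mul AM trmx0 !mulmx0.
have NM : N *m M = 1%:M - V by rewrite /V opprB addrC subrK.
clearbody V; pose D := V *m C *m V.
have Dsym : D^T = D by rewrite /D !trmx_mul Vsym Csym mulmxA.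
(* The row operation has to turn [C] into [V C V]. The symmetric part [(1 - V) C (1 - V)] is removed
   half by [G M] and half by its transpose, whence the factor one half. *)
pose G := - (V *m C + 2^-1 *: ((1%:M - V) *m C)) *m N.
have GA : G *m A = 0 by rewrite /G -mulmxA NA mulmx0.
have GM : G *m M = - (2^-1 *: (C + V *m C - C *m V - D)).
  rewrite /G -mulmxA NM !mulNmx mulmxDl mulmxBr mulmx1 -scalemxAl.
  rewrite mulmxBl mul1mx mulmxBr mulmx1 mulmxBl; congr (- _).
  rewrite ?/D; move: (V *m C) (C *m V) (V *m C *m V) => W1 W2 W3.
  by apply/matrixP => i j; rewrite !mxE; field.
have CE : C + G *m M + (G *m M)^T = D.
  have -> : (G *m M)^T = - (2^-1 *: (C + C *m V - V *m C - D)).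
    rewrite GM raddfN /= trmxZ !(raddfB, raddfD) /=.
    by rewrite !trmx_mul Csym Vsym mulmxA.
  rewrite GM; rewrite ?/D; move: (V *m C) (C *m V) (V *m C *m V) => W1 W2 W3.
  by apply/matrixP => i j; rewrite !mxE; field.
have uS : (block_mx 1%:M 0 G 1%:M : 'M[R]_(m + n)) \in unitmx.
  by rewrite unitmxE det_lblock !det1 mulr1 unitr1.
have Hsym : (block_mx A M M^T C)^T = block_mx A M M^T C.
  by rewrite tr_block_mx Asym Csym trmxK.
rewrite -(ind_congr Hsym uS) tr_block_mx !mulmx_block.
rewrite !trmx1 trmx0 !(mul0mx, mulmx0, mulmx1, mul1mx, addr0, add0r) GA add0r.
have -> : A *m G^T = 0 by rewrite -Asym -trmx_mul GA trmx0.
rewrite add0r -trmx_mul addrC [G *m M + C]addrC CE.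
have -> : block_mx A M M^T D = block_mx A 0 0 D + block_mx 0 M M^T 0.
  by rewrite add_block_mx !addr0 !add0r.
have MD : M *m D = 0 by rewrite /D !mulmxA MV !mul0mx.
rewrite ind_add_orth.
- by rewrite ind_block_diag // ind_hyperbolic addnAC.
- by rewrite tr_block_mx Asym Dsym !trmx0.
- by rewrite tr_block_mx trmxK !trmx0.
rewrite mulmx_block AM -[D]Dsym -trmx_mul MD trmx0.
by rewrite !(mul0mx, mulmx0, addr0) block_mx0.
Qed.

End IndexCalculus.

(** * Slopes of Lagrangian planes *)

Section Slopes.
Variables (R : realType) (n : nat).
Implicit Types (Y Yh Z : 'M[R]_(n + n, n)) (lam e : R).

(** Up to the choice of basis this is the Wronskian with the plane [(I; lam I)], see
    [wronskian_line]; it is invertible exactly when [Y] is transversal to that plane. *)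
Definition frame lam Y : 'M[R]_n := dsubmx Y - lam *: usubmx Y.

Definition slope lam Y : 'M[R]_n := usubmx Y *m invmx (frame lam Y).

(** The values [e = 1] and [e = -1] give the comparative index and its dual, so that both are
    treated by one argument. *)
Definition signed_cind e Y Yh : nat :=
  (\rank (cind_M Y Yh) + ind (e *: cind_P Y Yh))%N.

Lemma wronskianE Y Yh : wronskian Y Yh =
  (usubmx Y)^T *m dsubmx Yh - (dsubmx Y)^T *m usubmx Yh.
Proof.
rewrite /wronskian /Jmx -{1}[Y]vsubmxK -{1}[Yh]vsubmxK tr_col_mx.
rewrite mul_row_block !mulmx0 mulmx1 mulmxN mulmx1 addr0 add0r mul_row_col.
by rewrite mulNmx addrC.
Qed.

(** Replacing [U] by [U - lam X] is a symplectic shear, which preserves Wronskians. *)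
Lemma wronskian_frame lam Y Yh : wronskian Y Yh =
  (usubmx Y)^T *m frame lam Yh - (frame lam Y)^T *m usubmx Yh.
Proof.
rewrite wronskianE /frame trmxB trmxZ mulmxBr mulmxBl -scalemxAr -scalemxAl.
by rewrite opprB addrA subrK.
Qed.

Lemma tr_wronskian Y Yh : (wronskian Y Yh)^T = - wronskian Yh Y.
Proof. by rewrite !wronskianE trmxB !trmx_mul !trmxK opprB. Qed.

Lemma frame_sym lam Y : lagrangian_plane Y ->
  (frame lam Y)^T *m usubmx Y = (usubmx Y)^T *m frame lam Y.
Proof.
move=> [+ _]; rewrite -/(wronskian Y Y) (wronskian_frame lam) => /eqP.
by rewrite subr_eq0 => /eqP.
Qed.

Lemma slopeK lam Y : frame lam Y \in unitmx ->
  slope lam Y *m frame lam Y = usubmx Y.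
Proof. by move=> uK; rewrite mulmxKV. Qed.

Lemma slope_sym lam Y : lagrangian_plane Y -> frame lam Y \in unitmx ->
  (slope lam Y)^T = slope lam Y.
Proof.
move=> LY uK; rewrite /slope trmx_mul trmx_inv.
apply: (can_inj (mulmxK uK)); rewrite mulmxKV // -mulmxA -frame_sym //.
by rewrite mulKmx ?unitmx_tr.
Qed.

Lemma mxrank_unit_congr (K L : 'M[R]_n) (A : 'M[R]_n) :
  K \in unitmx -> L \in unitmx -> \rank (K *m A *m L) = \rank A.
Proof.
move=> uK uL; rewrite mxrankMfree ?row_free_unit // eqmxMfull //.
by rewrite row_full_unit.
Qed.

Lemma rank_slope lam Y : frame lam Y \in unitmx ->
  \rank (slope lam Y) = \rank (usubmx Y).
Proof. by move=> uK; rewrite mxrankMfree ?row_free_unit ?unitmx_inv. Qed.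

Lemma wronskian_slope lam Y Yh :
    lagrangian_plane Y -> frame lam Y \in unitmx -> frame lam Yh \in unitmx ->
  wronskian Y Yh =
  (frame lam Y)^T *m (slope lam Y - slope lam Yh) *m frame lam Yh.
Proof.
move=> LY uK uL; rewrite (wronskian_frame lam).
rewrite [X in _ = X *m _]mulmxBr [RHS]mulmxBl; congr (_ - _).
  by rewrite /slope mulmxA frame_sym // mulmxK.
by rewrite -[RHS]mulmxA slopeK.
Qed.

Lemma rank_slopeB lam Y Yh :
    lagrangian_plane Y -> frame lam Y \in unitmx -> frame lam Yh \in unitmx ->
  \rank (slope lam Y - slope lam Yh) = \rank (wronskian Y Yh).
Proof.
by move=> LY uK uL; rewrite (wronskian_slope LY uK uL) mxrank_unit_congr ?unitmx_tr.
Qed.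

(* Both sides compute the index of the form [[A, B], [B, B]], with [A], [B] the
   slopes of [Y], [Yh]: the right-hand side splits off the second block, the
   left-hand side the first one (which may be singular). *)
Lemma signed_cind_slope e lam Y Yh : e * e = 1 ->
    lagrangian_plane Y -> lagrangian_plane Yh ->
    frame lam Y \in unitmx -> frame lam Yh \in unitmx ->
  (signed_cind e Y Yh + ind (e *: slope lam Y) =
   ind (e *: (slope lam Y - slope lam Yh)) + ind (e *: slope lam Yh))%N.
Proof.
move=> ee LY LYh uK uL; rewrite /signed_cind /cind_P /cind_V.
have Asym := slope_sym LY uK; have Bsym := slope_sym LYh uL.
have KX := frame_sym lam LY; have LXh := frame_sym lam LYh.
have AK := slopeK uK; have BL := slopeK uL.
have WE : cind_M Y Yh = (1%:M - mpinv (usubmx Y) *m usubmx Y) *m wronskian Y Yh by [].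
rewrite tr_wronskian (wronskian_frame lam Yh Y) opprB.
rewrite (wronskian_frame lam Y Yh) in WE.
move: (cind_M Y Yh) WE; move: (slope lam Y) (slope lam Yh) AK BL Asym Bsym.
move: (frame lam Y) (frame lam Yh) uK uL KX LXh.
move: (usubmx Y) (usubmx Yh) => X Xh K L uK uL KX LXh A B AK BL Asym Bsym M ME.
have [X1 X2 X3 X4] := mpinvP X; set G := mpinv X in X1 X2 X3 X4 ME *.
have [M1 M2 M3 M4] := mpinvP M; set V := 1%:M - _.
have MV : M *m V = 0 by rewrite /V mulmxBr mulmx1 mulmxA M1 subrr.
have Vsym : V^T = V by rewrite /V trmxB trmx1 M4.
have uKT : K^T \in unitmx by rewrite unitmx_tr.
have KA : K^T *m A = X^T by rewrite -Asym -trmx_mul AK.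
have LB : L^T *m B = Xh^T by rewrite -Bsym -trmx_mul BL.
(* [T] is chosen so that [K^T X T] is the projection [G X] of [K^T Xh] onto the row space of [X];
   the part of [K^T Xh] that this misses is [- M]. *)
pose T := invmx K *m G^T *m K^T *m Xh.
have XGX : X^T *m G^T = G *m X by rewrite -trmx_mul X4.
have AT : K^T *m X *m T = G *m X *m (K^T *m Xh).
  by rewrite /T KX -!mulmxA mulKVmx // !mulmxA XGX.
have PX : G *m X *m X^T = X^T by rewrite -XGX -!trmx_mul mulmxA X1.
have XM : X *m M = 0.
  have XP : X *m (1%:M - G *m X) = 0 by rewrite mulmxBr mulmx1 mulmxA X1 subrr.
  by rewrite ME mulmxA XP mul0mx.
have {}ME : M = K^T *m X *m T - K^T *m Xh.
  rewrite AT ME mulmxBl mul1mx mulmxBr (mulmxA _ X^T) PX.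
  move: (X^T *m L) (K^T *m Xh) (G *m X *m (K^T *m Xh)) => a b c.
  by apply/matrixP => i j; rewrite !mxE; ring.
(* [C] is the lower right block that remains after subtracting [T^T] times the first block row of
   [H0] from the second, and likewise for columns. *)
clearbody T; pose C := L^T *m Xh - T^T *m (K^T *m Xh) - (T^T *m (K^T *m Xh))^T +
  T^T *m (K^T *m X) *m T.
have Csym : C^T = C.
  rewrite /C !(trmxB, trmxD) !trmx_mul !trmxK LXh KX !mulmxA; congr (_ + _).
  by rewrite addrAC.
(* This is the form [[[A, B], [B, B]]] transported by the block diagonal matrix of [K] and [L]. *)
pose H0 := block_mx (K^T *m X) (K^T *m Xh) (Xh^T *m K) (L^T *m Xh).
have H0sym : H0^T = H0.
  by rewrite tr_block_mx !trmx_mul !trmxK -KX -LXh.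
have indH : ind (e *: H0) = (ind (e *: (A - B)) + ind (e *: B))%N.
  have eABsym : (e *: (A - B))^T = e *: (A - B) by rewrite trmxZ trmxB Asym Bsym.
  have eBsym : (e *: B)^T = e *: B by rewrite trmxZ Bsym.
  rewrite -ind_block_diag //.
  pose S := block_mx K^T K^T 0 L^T.
  have uS : S \in unitmx.
    by rewrite unitmxE det_ublock unitrM -!unitmxE !unitmx_tr uK uL.
  rewrite -[RHS](ind_congr _ uS); last by rewrite tr_block_mx !trmx0 eABsym eBsym.
  congr ind; rewrite tr_block_mx !trmxK trmx0 !mulmx_block scale_block_mx.
  rewrite !(mul0mx, mulmx0, addr0, add0r) -!scalemxAr -!scalemxAl -scalerDr.
  by rewrite -mulmxDl -mulmxDr subrK LB LXh -!(mulmxA _ A) -!(mulmxA _ B) AK BL.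
have indA : ind (e *: A) = ind (e *: (K^T *m X)).
  rewrite -[LHS](ind_congr _ uKT); last by rewrite trmxZ Asym.
  by rewrite trmxK -scalemxAr -scalemxAl -mulmxA AK.
have indH' : ind (e *: H0) =
    (ind (e *: (K^T *m X)) + \rank M + ind (e *: (V *m C *m V)))%N.
  have -> : e *: (V *m C *m V) = V *m (e *: C) *m V.
    by rewrite -scalemxAr -scalemxAl.
  rewrite -ind_bordered; last first.
  - by rewrite -scalemxAl -mulmxA XM mulmx0 scaler0.
  - by rewrite trmxZ Csym.
  - by rewrite trmxZ trmx_mul trmxK KX.
  (* The entry [- e] cancels the factor [e] in the off-diagonal blocks, which become exactly [M] and
     [M^T]. *)
  pose S := block_mx 1%:M 0 (e *: T^T) (- e)%:M.
  have uS : S \in unitmx.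
    rewrite unitmxE det_lblock det1 mul1r det_scalar unitrX // unitrN.
    by apply/unitrP; exists e.
  rewrite -[LHS](ind_congr _ uS); last by rewrite trmxZ H0sym.
  congr ind; rewrite tr_block_mx scale_block_mx !mulmx_block.
  rewrite trmx1 trmx0 trmxZ trmxK tr_scalar_mx.
  rewrite !(mul0mx, mulmx0, addr0, add0r, mul1mx, mulmx1).
  rewrite !(mul_mx_scalar, mul_scalar_mx) -!scalemxAr -!scalemxAl !scalerA.
  rewrite !mulNr ee !scaleNr !scale1r -ME.
  have -> : T^T *m (K^T *m X) - Xh^T *m K = M^T.
    by rewrite ME trmxB !trmx_mul trmxK KX mulmxA.
  congr block_mx; rewrite -scalerBr; congr (_ *: _).
  rewrite ME /C trmxB mulmxBl !trmx_mul !trmxK -KX !mulmxA.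
  move: (T^T *m K^T *m X *m T) (Xh^T *m K *m T) (T^T *m K^T *m Xh) => a b c.
  by apply/matrixP => i j; rewrite !mxE; ring.
(* On the range of [V] the equation [M V = 0] reads [Xh V = X T V]; this identifies the matrix in
   the definition of the comparative index with the compression of [C]. *)
have -> : V *m (L^T *m X - Xh^T *m K) *m G *m Xh *m V = V *m C *m V.
  clearbody V; have E2 : Xh *m V = X *m T *m V.
    apply: (can_inj (mulKmx uKT)); rewrite !mulmxA; apply/eqP.
    by rewrite eq_sym -subr_eq0 -mulmxBl -ME MV.
  have E3 : V *m Xh^T = V *m T^T *m X^T.
    by rewrite -{1}Vsym -trmx_mul E2 !trmx_mul Vsym mulmxA.
  have XGXT : X *m (G *m (X *m T *m V)) = X *m T *m V by rewrite !mulmxA X1.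
  have q1 : V *m (T^T *m (K^T *m Xh)) *m V = V *m T^T *m K^T *m (X *m T *m V).
    by rewrite -E2 !mulmxA.
  have q2 : V *m (T^T *m (K^T *m Xh))^T *m V = V *m T^T *m K^T *m (X *m T *m V).
    rewrite !trmx_mul !trmxK !mulmxA E3 -(mulmxA _ X^T) -KX.
    by rewrite !mulmxA.
  rewrite /C [in RHS]mulmxDr [in RHS]mulmxDl !mulmxBr !mulmxBl q1 q2.
  have -> : V *m (T^T *m (K^T *m X) *m T) *m V = V *m T^T *m K^T *m (X *m T *m V).
    by rewrite !mulmxA.
  rewrite subrK -!mulmxA E2 XGXT; congr (_ - _).
  have -> : V *m (Xh^T *m (K *m (G *m (X *m T *m V)))) =
      V *m T^T *m (X^T *m K) *m (G *m (X *m T *m V)).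
    by rewrite [LHS]mulmxA E3 !mulmxA.
  by move: XGXT; rewrite -KX -!mulmxA => ->.
by rewrite -indH indH' indA addnC addnA.
Qed.

End Slopes.

(** * A common transversal plane for finitely many Lagrangian planes *)

Section FrameChoice.
Variables (R : realType) (n : nat).
Implicit Types (Y : 'M[R]_(n + n, n)) (lam : R).

Lemma lagrangian_gram_unit Y : lagrangian_plane Y ->
  (dsubmx Y)^T *m dsubmx Y + (usubmx Y)^T *m usubmx Y \in unitmx.
Proof.
move=> [_ rkY]; rewrite addrC -mul_row_col -tr_col_mx vsubmxK.
rewrite -[X in _ *m X]trmxK; apply: row_free_gram.
by rewrite /row_free mxrank_tr rkY.
Qed.

Lemma frame_unit_mx lam Y : lagrangian_plane Y ->
  (dsubmx Y)^T *m dsubmx Y - lam ^+ 2 *: ((usubmx Y)^T *m usubmx Y) \in unitmx ->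
  frame lam Y \in unitmx.
Proof.
move=> LY; have XU := frame_sym 0 LY.
rewrite /frame scale0r subr0 in XU.
have -> : (dsubmx Y)^T *m dsubmx Y - lam ^+ 2 *: ((usubmx Y)^T *m usubmx Y) =
    (dsubmx Y + lam *: usubmx Y)^T *m frame lam Y.
  rewrite /frame trmxD trmxZ mulmxDl !mulmxBr -!scalemxAr -!scalemxAl XU.
  by rewrite scalerA addrA subrK expr2.
by rewrite unitmx_mul => /andP[].
Qed.

(* det (U^T U - lam^2 X^T X) = det (U + lam X)^T det (U - lam X) is a nonzero
   polynomial in - lam^2: at 1 it is the Gram determinant of [Y]. *)
Lemma exists_frame_unit (s : seq 'M[R]_(n + n, n)) :
    (forall Y, Y \in s -> lagrangian_plane Y) ->
  exists lam, forall Y, Y \in s -> frame lam Y \in unitmx.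
Proof.
move=> Ls.
pose pm Y : 'M[{poly R}]_n := map_mx polyC ((dsubmx Y)^T *m dsubmx Y) +
  'X *: map_mx polyC ((usubmx Y)^T *m usubmx Y).
have pmE Y x : (\det (pm Y)).[x] =
    \det ((dsubmx Y)^T *m dsubmx Y + x *: ((usubmx Y)^T *m usubmx Y)).
  rewrite -/(horner_eval x _) -det_map_mx; congr (\det _).
  rewrite /pm; move: (_ *m dsubmx Y) (_ *m usubmx Y) => P Q.
  by apply/matrixP => i j; rewrite !mxE /= /horner_eval !hornerE.
pose q := \prod_(Y <- s) \det (pm Y).
have q0 : q != 0.
  rewrite prodf_seq_neq0; apply/allP => Y Ys /=.
  apply: contraTneq (lagrangian_gram_unit (Ls _ Ys)) => p0.
  by rewrite unitmxE unitfE negbK -[X in _ + X]scale1r -pmE p0 horner0.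
(* These are [size q] distinct points, more than the degree of [q], so one of them is not a root;
   each is minus a square, as required for a real [lam]. *)
pose r := [seq - (k%:R : R) ^+ 2 | k <- iota 0 (size q)].
have r_uniq : uniq r.
  rewrite map_inj_in_uniq ?iota_uniq // => i j _ _ /oppr_inj /eqP.
  by rewrite eqrXn2 ?ler0n // eqr_nat => /eqP.
have : ~~ all (root q) r.
  apply/negP => /(max_poly_roots q0)/(_ r_uniq).
  by rewrite size_map size_iota ltnn.
move=> /allPn[_ /mapP[k _ ->] qk]; exists k%:R => Y Ys.
apply: frame_unit_mx; first exact: Ls.
rewrite -scaleNr unitmxE unitfE -pmE; apply: contra qk => /eqP p0.
rewrite rootE horner_prod; apply/eqP.
by rewrite (big_rem Y) //= p0 mul0r.
Qed.

End FrameChoice.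

(** * Entrywise limits of matrices along a filter *)

Section EntrywiseLimits.
Variables (R : realType) (T : Type) (F : set_system T).
Hypothesis FF : Filter F.

Definition mx_cvg m n (A : T -> 'M[R]_(m, n)) (B : 'M[R]_(m, n)) :=
  forall i j, A x i j @[x --> F] --> B i j.

Lemma cvg_mxP m n (A : T -> 'M[R]_(m, n)) (B : 'M[R]_(m, n)) :
  A x @[x --> F] --> B <-> mx_cvg A B.
Proof.
split=> [AB i j|AB]; first exact: (cvg_comp _ _ AB (@coord_continuous R m n i j B)).
move=> /= S [P PB PS]; rewrite nbhs_filterE.
have : \forall x \near F, forall i j, P i j (A x i j).
  by apply: filter_forall => i; apply: filter_forall => j; exact: AB (PB i j).
by apply: filterS => x Px; apply: PS.
Qed.

Lemma mx_cvg_cst m n (B : 'M[R]_(m, n)) : mx_cvg (fun=> B) B.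
Proof. by move=> i j; exact: cvg_cst. Qed.

Lemma mx_cvgM m n p (A : T -> 'M[R]_(m, n)) (B : T -> 'M[R]_(n, p)) A0 B0 :
  mx_cvg A A0 -> mx_cvg B B0 -> mx_cvg (fun x => A x *m B x) (A0 *m B0).
Proof.
move=> cA cB i j; rewrite mxE; under eq_fun do rewrite mxE.
by apply: cvg_big => [|k _]; [exact: add_continuous|exact: cvgM].
Qed.

Lemma mx_cvgB m n (A B : T -> 'M[R]_(m, n)) A0 B0 :
  mx_cvg A A0 -> mx_cvg B B0 -> mx_cvg (fun x => A x - B x) (A0 - B0).
Proof.
move=> cA cB i j; rewrite !mxE; under eq_fun do rewrite !mxE.
exact: cvgB.
Qed.

Lemma mx_cvgZ m n (A : T -> 'M[R]_(m, n)) A0 c :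
  mx_cvg A A0 -> mx_cvg (fun x => c *: A x) (c *: A0).
Proof.
move=> cA i j; rewrite !mxE; under eq_fun do rewrite !mxE.
by apply: cvgM => //; exact: cvg_cst.
Qed.

Lemma mx_cvg_usub m1 m2 n (A : T -> 'M[R]_(m1 + m2, n)) A0 :
  mx_cvg A A0 -> mx_cvg (fun x => usubmx (A x)) (usubmx A0).
Proof. by move=> cA i j; rewrite !mxE; under eq_fun do rewrite !mxE; exact: cA. Qed.

Lemma mx_cvg_dsub m1 m2 n (A : T -> 'M[R]_(m1 + m2, n)) A0 :
  mx_cvg A A0 -> mx_cvg (fun x => dsubmx (A x)) (dsubmx A0).
Proof. by move=> cA i j; rewrite !mxE; under eq_fun do rewrite !mxE; exact: cA. Qed.

Lemma cvg_det n (A : T -> 'M[R]_n) A0 :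
  mx_cvg A A0 -> \det (A x) @[x --> F] --> \det A0.
Proof.
move=> cA; apply: cvg_big => [|s _]; first exact: add_continuous.
apply: cvgM; first exact: cvg_cst.
by apply: cvg_big => [|i _]; [exact: mul_continuous|exact: cA].
Qed.

Lemma near_unitmx n (A : T -> 'M[R]_n) A0 :
  mx_cvg A A0 -> A0 \in unitmx -> \forall x \near F, A x \in unitmx.
Proof.
move=> /cvg_det cA; rewrite unitmxE unitfE => A0u.
have : \forall x \near F, \det (A x) != 0 by exact: cvgr_neq0 cA A0u.
by apply: filterS => x; rewrite unitmxE unitfE.
Qed.

(** Cramer's rule: near the limit the determinant is nonzero, and the entries of the inverse are
    quotients of determinants. *)
Lemma mx_cvgV n (A : T -> 'M[R]_n) A0 :
  mx_cvg A A0 -> A0 \in unitmx -> mx_cvg (fun x => invmx (A x)) (invmx A0).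
Proof.
move=> cA A0u i j.
have E (B : 'M[R]_n) : B \in unitmx -> invmx B i j = (\det B)^-1 * \adj B i j.
  by move=> uB; rewrite /invmx uB mxE.
rewrite E //.
apply: (cvg_trans (near_eq_cvg (f := fun x => (\det (A x))^-1 * \adj (A x) i j) _)).
  by apply: filterS (near_unitmx cA A0u) => x /E ->.
apply: cvgM; first by apply: cvgV; [rewrite -unitfE -unitmxE|exact: cvg_det].
rewrite mxE; under eq_fun do rewrite mxE.
apply: cvgM; first exact: cvg_cst.
by apply: cvg_det => k l; rewrite !mxE; under eq_fun do rewrite !mxE; exact: cA.
Qed.

End EntrywiseLimits.

(** * Local constancy *)

Section IndexContinuity.
Variables (R : realType) (T : Type) (F : set_system T).
Hypothesis FF : Filter F.

(** Lower semicontinuity: a witness [N] for [Q0] makes [N Q N^T] close to [- I], hence still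
    negative definite. *)
Lemma near_ind_ge n (Q : T -> 'M[R]_n) (Q0 : 'M[R]_n) :
    Q0^T = Q0 -> (\forall x \near F, (Q x)^T = Q x) -> mx_cvg F Q Q0 ->
  \forall x \near F, (ind Q0 <= ind (Q x))%N.
Proof.
move=> Q0sym Qsym QQ0.
have [k [N [<- NQN]]] : exists k (N : 'M[R]_(k, n)),
    k = ind Q0 /\ N *m Q0 *m N^T = - 1%:M.
  by have [N NQN] := ind_witness Q0sym; exists (ind Q0), N.
(* An entrywise error below [eps] changes the form by at most [eps * k] times the squared length of
   [v], which is less than that squared length. *)
pose eps : R := k.+1%:R^-1; have eps_gt0 : 0 < eps by rewrite invr_gt0 ltr0n.
have near_eps : \forall x \near F, forall i j,
    `|(- 1%:M : 'M[R]_k) i j - (N *m Q x *m N^T) i j| < eps.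
  apply: filter_forall => i; apply: filter_forall => j.
  apply: cvgr_dist_lt => //; rewrite -NQN.
  by apply: mx_cvgM; [apply: mx_cvgM => //|]; exact: mx_cvg_cst.
apply: filterS2 Qsym near_eps => x Qxsym Qx_eps.
apply: (ind_max_negdef (N := N)) => // v v0; have sv := sqr_sum_gt0 v0.
set S := N *m Q x *m N^T in Qx_eps *; set sq := \sum_j v 0 j ^+ 2 in sv.
have -> : (v *m S *m v^T) 0 0 = (v *m (S + 1%:M) *m v^T) 0 0 - sq.
  by rewrite mulmxDr mulmx1 mulmxDl mulmx_trmx_rowE !mxE eqxx mulr1n addrK.
rewrite subr_lt0; apply: (@le_lt_trans _ _ (eps * (k%:R * sq))); last first.
  rewrite mulrA gtr_pMl // /eps mulrC ltr_pdivrMr ?ltr0n // mul1r ltr_nat.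
  exact: ltnSn.
(* Each product [v_i v_j] is bounded in absolute value by the mean of the two squares. *)
apply: (@le_trans _ _
  (\sum_(j < k) \sum_(i < k) eps * ((v 0 i ^+ 2 + v 0 j ^+ 2) / 2))).
  rewrite mxE; apply: ler_sum => j _; rewrite mxE mulr_suml.
  apply: ler_sum => i _; rewrite [v^T j 0]mxE mulrAC mulrC.
  apply: (le_trans (ler_norm _)); rewrite normrM ler_pM //.
    have := Qx_eps i j; rewrite distrC => /ltW; apply: le_trans.
    by rewrite !mxE opprK.
  rewrite normrM -(real_normK (num_real (v 0 i))) -(real_normK (num_real (v 0 j))).
  by have := sqr_ge0 (`|v 0 i| - `|v 0 j|); rewrite sqrrB; lra.
under eq_bigr do rewrite -mulr_sumr -mulr_suml big_split /= sumr_const card_ord.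
rewrite -mulr_sumr -mulr_suml big_split /= sumr_const card_ord sumrMnl -/sq.
by rewrite -mulr_natl le_eqVlt; apply/orP; left; apply/eqP; field.
Qed.

(** Semicontinuity for [Q] and for [- Q]: the two indices add up to the rank, which is constant, so
    neither can jump up. *)
Lemma near_ind_eq n (Q : T -> 'M[R]_n) (Q0 : 'M[R]_n) :
    Q0^T = Q0 -> (\forall x \near F, (Q x)^T = Q x) -> mx_cvg F Q Q0 ->
    (\forall x \near F, \rank (Q x) = \rank Q0) ->
  \forall x \near F, ind (Q x) = ind Q0.
Proof.
move=> Q0sym Qsym QQ0 rkQ; have le1 := near_ind_ge Q0sym Qsym QQ0.
have le2 : \forall x \near F, (ind (- Q0) <= ind (- Q x))%N.
  apply: near_ind_ge; first by rewrite trmxN Q0sym.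
  - by apply: filterS Qsym => x Qx; rewrite trmxN Qx.
  - move=> i j; rewrite !mxE; under eq_fun do rewrite !mxE; exact: cvgN.
apply: filterS (filterI (filterI Qsym rkQ) (filterI le1 le2)) => x [[Qx rk] [l1 l2]].
by have := ind_add_opp Qx; have := ind_add_opp Q0sym; lia.
Qed.

End IndexContinuity.

Section LocalConstancy.
Variables (R : realType) (n : nat) (T : Type) (F : set_system T) (x0 : T).
Hypothesis FF : Filter F.
Implicit Types (Y Yh Z Zh : T -> 'M[R]_(n + n, n)) (lam e : R).

(** The filter is left abstract; taking the neighbourhoods of a point within an interval later
    treats endpoints and interior points alike. *)
Definition lagrangian_near Y := [/\ lagrangian_plane (Y x0),
  \forall x \near F, lagrangian_plane (Y x) & mx_cvg F Y (Y x0)].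

Lemma near_frame lam Y : lagrangian_near Y -> frame lam (Y x0) \in unitmx ->
  \forall x \near F, frame lam (Y x) \in unitmx.
Proof.
move=> [_ _ cY] uY; apply: (near_unitmx _ _ uY).
by apply: mx_cvgB; [exact: mx_cvg_dsub|apply: mx_cvgZ; exact: mx_cvg_usub].
Qed.

Lemma mx_cvg_slope lam Y : lagrangian_near Y -> frame lam (Y x0) \in unitmx ->
  mx_cvg F (fun x => slope lam (Y x)) (slope lam (Y x0)).
Proof.
move=> [_ _ cY] uY; apply: mx_cvgM; first exact: mx_cvg_usub.
apply: mx_cvgV => //.
by apply: mx_cvgB; [exact: mx_cvg_dsub|apply: mx_cvgZ; exact: mx_cvg_usub].
Qed.

Lemma near_ind_slope e lam Y : e != 0 -> lagrangian_near Y ->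
    frame lam (Y x0) \in unitmx ->
    (\forall x \near F, \rank (usubmx (Y x)) = \rank (usubmx (Y x0))) ->
  \forall x \near F, ind (e *: slope lam (Y x)) = ind (e *: slope lam (Y x0)).
Proof.
move=> e0 LY uY rkY; have [L0 LF cY] := LY; have uF := near_frame LY uY.
apply: near_ind_eq.
- by rewrite trmxZ slope_sym.
- by apply: filterS2 LF uF => x Lx ux; rewrite trmxZ slope_sym.
- by apply: mx_cvgZ; exact: mx_cvg_slope.
- by apply: filterS2 rkY uF => x rk ux; rewrite !mxrank_scale_nz // !rank_slope.
Qed.

Lemma near_ind_slopeB e lam Y Yh : e != 0 ->
    lagrangian_near Y -> lagrangian_near Yh ->
    frame lam (Y x0) \in unitmx -> frame lam (Yh x0) \in unitmx ->
    (\forall x \near F,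
      \rank (wronskian (Y x) (Yh x)) = \rank (wronskian (Y x0) (Yh x0))) ->
  \forall x \near F, ind (e *: (slope lam (Y x) - slope lam (Yh x))) =
                     ind (e *: (slope lam (Y x0) - slope lam (Yh x0))).
Proof.
move=> e0 LY LYh uY uYh rkW; have [L0 LF cY] := LY; have [Lh0 LhF cYh] := LYh.
have uF := near_frame LY uY; have uhF := near_frame LYh uYh.
apply: near_ind_eq.
- by rewrite trmxZ trmxB !slope_sym.
- apply: filterS2 (filterI LF uF) (filterI LhF uhF) => x [? ?] [? ?].
  by rewrite trmxZ trmxB !slope_sym.
- by apply: mx_cvgZ; apply: mx_cvgB; exact: mx_cvg_slope.
- apply: filterS2 rkW (filterI (filterI LF uF) uhF) => x rk [[? ?] ?].
  by rewrite !mxrank_scale_nz // !rank_slopeB.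
Qed.

(* Writing the three comparative indices through slopes with respect to one
   plane transversal to everything, the terms of varying rank cancel. *)
Lemma near_signed_cind e Y Yh Z Zh : e * e = 1 ->
    lagrangian_near Y -> lagrangian_near Yh ->
    lagrangian_near Z -> lagrangian_near Zh ->
    (\forall x \near F,
      \rank (wronskian (Y x) (Yh x)) = \rank (wronskian (Y x0) (Yh x0))) ->
    (\forall x \near F,
      \rank (wronskian (Z x) (Y x)) = \rank (wronskian (Z x0) (Y x0))) ->
    (\forall x \near F,
      \rank (wronskian (Zh x) (Yh x)) = \rank (wronskian (Zh x0) (Yh x0))) ->
    (\forall x \near F, \rank (usubmx (Z x)) = \rank (usubmx (Z x0))) ->
    (\forall x \near F, \rank (usubmx (Zh x)) = \rank (usubmx (Zh x0))) ->
  let G x : int := (signed_cind e (Y x) (Z x))%:Z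
    - (signed_cind e (Yh x) (Zh x))%:Z - (signed_cind e (Y x) (Yh x))%:Z in
  \forall x \near F, G x = G x0.
Proof.
move=> ee LY LYh LZ LZh rkYYh rkZY rkZhYh rkZ rkZh G.
have e0 : e != 0 by apply: contra_eq_neq ee => ->; rewrite mul0r eq_sym oner_neq0.
have rkC (U V : T -> 'M[R]_(n + n, n)) : (\forall x \near F,
    \rank (wronskian (U x) (V x)) = \rank (wronskian (U x0) (V x0))) ->
  \forall x \near F,
    \rank (wronskian (V x) (U x)) = \rank (wronskian (V x0) (U x0)).
  have rkT (A B : 'M[R]_(n + n, n)) : \rank (wronskian A B) = \rank (wronskian B A).
    by rewrite -mxrank_tr tr_wronskian mxrank_opp.
  by apply: filterS => x; rewrite ![\rank (wronskian (U _) _)]rkT.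
have [LY0 LYF _] := LY; have [LYh0 LYhF _] := LYh.
have [LZ0 LZF _] := LZ; have [LZh0 LZhF _] := LZh.
have [|lam ulam] := @exists_frame_unit _ _ [:: Y x0; Yh x0; Z x0; Zh x0].
  by move=> P; rewrite !inE => /or4P[] /eqP ->.
have uY : frame lam (Y x0) \in unitmx by apply: ulam; rewrite !inE eqxx.
have uYh : frame lam (Yh x0) \in unitmx by apply: ulam; rewrite !inE eqxx !orbT.
have uZ : frame lam (Z x0) \in unitmx by apply: ulam; rewrite !inE eqxx !orbT.
have uZh : frame lam (Zh x0) \in unitmx by apply: ulam; rewrite !inE eqxx !orbT.
apply: filterS (filterI (filterI (filterI LYF LYhF) (filterI LZF LZhF))
 (filterI (filterI (filterI (near_frame LY uY) (near_frame LYh uYh))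
                  (filterI (near_frame LZ uZ) (near_frame LZh uZh)))
  (filterI (filterI (near_ind_slope e0 LZ uZ rkZ) (near_ind_slope e0 LZh uZh rkZh))
  (filterI (near_ind_slopeB e0 LY LYh uY uYh rkYYh)
   (filterI (near_ind_slopeB e0 LY LZ uY uZ (rkC _ _ rkZY))
            (near_ind_slopeB e0 LYh LZh uYh uZh (rkC _ _ rkZhYh))))))) => x.
move=> [] [[l1 l2] [l3 l4]] [[[f1 f2] [f3 f4]]] [[E1 E2] [E3 [E4 E5]]].
have key A B : lagrangian_plane A -> lagrangian_plane B ->
    frame lam A \in unitmx -> frame lam B \in unitmx ->
    (signed_cind e A B)%:Z = (ind (e *: (slope lam A - slope lam B)))%:Z +
      (ind (e *: slope lam B))%:Z - (ind (e *: slope lam A))%:Z.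
  by move=> LA LB uA uB; apply/eqP; rewrite eq_sym subr_eq -!PoszD signed_cind_slope.
(* Here [y] and [h] stand for the indices of the slopes of [Y] and [Yh], the only ones not known to
   be locally constant; they cancel. *)
have cancel (p q r a b y c d h f : int) : p = a + b - y -> q = c + d - h ->
    r = f + h - y -> p - q - r = a + b - (c + d) - f.
  by clear; lia.
have GE z : lagrangian_plane (Y z) -> lagrangian_plane (Yh z) ->
    lagrangian_plane (Z z) -> lagrangian_plane (Zh z) ->
    frame lam (Y z) \in unitmx -> frame lam (Yh z) \in unitmx ->
    frame lam (Z z) \in unitmx -> frame lam (Zh z) \in unitmx ->
  G z = (ind (e *: (slope lam (Y z) - slope lam (Z z))))%:Z +
    (ind (e *: slope lam (Z z)))%:Z -
    ((ind (e *: (slope lam (Yh z) - slope lam (Zh z))))%:Z +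
    (ind (e *: slope lam (Zh z)))%:Z) -
    (ind (e *: (slope lam (Y z) - slope lam (Yh z))))%:Z.
  by move=> ? ? ? ? ? ? ? ?; apply: cancel; apply: key.
rewrite (GE x l1 l2 l3 l4 f1 f2 f3 f4) (GE x0 LY0 LYh0 LZ0 LZh0 uY uYh uZ uZh).
have eq5 (a b c d f a' b' c' d' f' : nat) : a = a' -> b = b' -> c = c' ->
    d = d' -> f = f' -> a%:Z + b%:Z - (c%:Z + d%:Z) - f%:Z =
                        a'%:Z + b'%:Z - (c'%:Z + d'%:Z) - f'%:Z.
  by move=> -> -> -> -> ->.
exact: eq5 E4 E1 E5 E2 E3.
Qed.

End LocalConstancy.

(** * Induction along a compact interval *)

Section IntervalInduction.
Variable R : realType.

(** Let [c] be the supremum of the points reachable from [a]. The local hypothesis at [c] joins a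
    reachable point just below [c] to a point beyond [c], unless [c] is already [b]. *)
Lemma interval_induction (a b : R) (P : R -> R -> Prop) : a <= b ->
    (forall s u v, a <= s -> s <= u -> u <= v -> v <= b ->
      P s u -> P u v -> P s v) ->
    (forall x, a <= x <= b -> exists2 e, 0 < e & forall s v,
      a <= s -> s <= x -> x <= v -> v <= b -> x - e < s -> v < x + e -> P s v) ->
  P a b.
Proof.
move=> ab Ptrans Ploc.
pose S : set R := [set x | a <= x <= b /\ P a x].
have Sa : S a.
  split; first by rewrite lexx.
  have [|e e0 /(_ a a)] := Ploc a; first by rewrite lexx.
  by apply; rewrite ?lexx ?ltrDl // ltrBlDr ltrDl.
have supS : has_sup S by split; [exists a | exists b => x [/andP[]]].
pose c := sup S.
have ac : a <= c by apply: ub_le_sup => //; case: supS.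
have cb : c <= b by apply: ge_sup => [|x [/andP[]]]; [exists a|].
have [|e e0 Pc] := Ploc c; first by rewrite ac.
have [s [/andP[as_ sb] Pas] cs] := sup_adherent e0 supS.
have sc : s <= c by apply: ub_le_sup; [case: supS|split=> //; rewrite as_].
pose d := Num.min b (c + e / 2).
have cd : c <= d by rewrite le_min cb lerDl divr_ge0 // ltW.
have db : d <= b by rewrite ge_min lexx.
have Psd : P s d.
  apply: Pc => //; rewrite gt_min; apply/orP; right.
  by rewrite ltrD2l ltr_pdivrMr // mulr_natr mulr2n ltrDl.
have Pad : P a d by apply: (Ptrans a s d) => //; exact: le_trans cd.
have : d <= c by apply: ub_le_sup; [case: supS|split=> //; rewrite db (le_trans ac)].
rewrite ge_min => /orP[bc|]; last by rewrite gerDl leNgt divr_gt0.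
have dc : d = b by rewrite /d; apply/min_idPl; rewrite (le_trans bc) // lerDl divr_ge0 // ltW.
by rewrite -dc.
Qed.

Lemma near_within_itv (a b x : R) (Q : R -> Prop) :
    (\forall y \near within `[a, b] (nbhs x), Q y) ->
  exists2 e, 0 < e & forall y, y \in `[a, b] -> x - e < y < x + e -> Q y.
Proof.
rewrite near_withinE => /nbhs_ballP[e /= e0 eQ]; exists e => // y yab /andP[y1 y2].
apply: eQ => //=; rewrite /ball /= distrC ltr_distl y1 y2 //.
Qed.

Lemma locally_constant_itv (a b : R) (G : R -> int) : a <= b ->
    (forall x, x \in `[a, b] -> \forall y \near within `[a, b] (nbhs x), G y = G x) ->
  G a = G b.
Proof.
move=> ab Gloc; apply: (@interval_induction a b (fun s v => G s = G v)) => //.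
  by move=> s u v _ _ _ _ -> ->.
move=> x xab; have [e e0 eG] := near_within_itv (Gloc x xab).
exists e => // s v as_ sx xv vb xs vx.
have [ax xb] := andP xab.
rewrite eG ?eG //.
- by rewrite in_itv /= vb (le_trans ax).
- by rewrite vx (lt_le_trans _ xv) // ltrBlDr ltrDl.
- by rewrite in_itv /= as_ (le_trans sx).
- by rewrite xs (le_lt_trans sx) // ltrDl.
Qed.

End IntervalInduction.

(** * Lagrangian paths and increments of the comparative index *)

Section OscillationSums.
Variables (R : realType) (n : nat).
Implicit Types (Y Yh Z Zh : R -> 'M[R]_(n + n, n)) (e : R).

Lemma lagrangian_path_near (a b x : R) Y : lagrangian_path a b Y ->
  x \in `[a, b] -> lagrangian_near (within `[a, b] (nbhs x)) x Y.
Proof.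
move=> [cY LY] xab; split; first exact: LY.
  by apply: filterS (withinT _ _) => y; exact: LY.
by apply/cvg_mxP; move/subspace_continuousP: cY => /(_ x xab).
Qed.

Lemma lagrangian_path_sub (a b c d : R) Y : a <= c -> d <= b ->
  lagrangian_path a b Y -> lagrangian_path c d Y.
Proof.
move=> ac db [cY LY]; have sub s : s \in `[c, d] -> s \in `[a, b].
  by rewrite !in_itv /= => /andP[cs sd]; rewrite (le_trans ac) // (le_trans sd).
split; last by move=> s /sub; exact: LY.
by apply: continuous_subspaceW cY => s /= /sub.
Qed.

Lemma symplectic_unit (S : 'M[R]_(n + n)) : symplectic S -> S \in unitmx.
Proof.
have JJ : Jmx *m - Jmx = 1%:M :> 'M[R]_(n + n).
  rewrite mulmxN mulmx_block !(mul0mx, mulmx0, mulmx1, mul1mx, addr0, add0r).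
  by rewrite opp_block_mx !oppr0 !opprK -scalar_mx_block.
have [uJ _] := mulmx1_unit JJ.
by move=> SJS; move: uJ; rewrite -SJS unitmx_mul => /andP[].
Qed.

Lemma symplectic_lagrangian (S : 'M[R]_(n + n)) (C : 'M[R]_(n + n, n)) :
  symplectic S -> lagrangian_plane C -> lagrangian_plane (S *m C).
Proof.
move=> SS [CC rC]; split.
  by rewrite trmx_mul !mulmxA -(mulmxA C^T) -(mulmxA C^T) SS.
by rewrite eqmxMfull ?rC // row_full_unit symplectic_unit.
Qed.

Lemma lagrangian_Emx : lagrangian_plane (Emx : 'M[R]_(n + n, n)).
Proof.
split; last by rewrite rank_col_0mx mxrank1.
rewrite -/(wronskian Emx Emx) wronskianE /Emx col_mxKu col_mxKd.
by rewrite trmx0 mul0mx mulmx0 subr0.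
Qed.

Lemma path_mul (a b : R) (S : R -> 'M[R]_(n + n)) (C : 'M[R]_(n + n, n)) :
    {within `[a, b], continuous S} ->
    (forall s, s \in `[a, b] -> symplectic (S s)) -> lagrangian_plane C ->
  lagrangian_path a b (fun s => S s *m C).
Proof.
move=> cS SS LC; split; last by move=> s /SS ?; apply: symplectic_lagrangian.
apply/subspace_continuousP => x xab; apply/cvg_mxP; apply: mx_cvgM.
  by apply/cvg_mxP; move/subspace_continuousP: cS => /(_ x xab).
exact: mx_cvg_cst.
Qed.

Lemma signed_cind_interval e (a b : R) Y Yh Z Zh : e * e = 1 -> a <= b ->
    lagrangian_path a b Y -> lagrangian_path a b Yh ->
    lagrangian_path a b Z -> lagrangian_path a b Zh ->
    {in `[a, b] &, forall s s', \rank (wronskian (Y s) (Yh s)) =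
                                \rank (wronskian (Y s') (Yh s'))} ->
    {in `[a, b] &, forall s s', \rank (wronskian (Z s) (Y s)) =
                                \rank (wronskian (Z s') (Y s'))} ->
    {in `[a, b] &, forall s s', \rank (wronskian (Zh s) (Yh s)) =
                                \rank (wronskian (Zh s') (Yh s'))} ->
    {in `[a, b] &, forall s s', \rank (usubmx (Z s)) = \rank (usubmx (Z s'))} ->
    {in `[a, b] &, forall s s', \rank (usubmx (Zh s)) = \rank (usubmx (Zh s'))} ->
  let G x : int := (signed_cind e (Y x) (Z x))%:Z
    - (signed_cind e (Yh x) (Zh x))%:Z - (signed_cind e (Y x) (Yh x))%:Z in
  G a = G b.
Proof.
move=> ee ab LY LYh LZ LZh r1 r2 r3 r4 r5 G.
apply: locally_constant_itv => // x xab.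
have near_rk (r : R -> nat) : {in `[a, b] &, forall s s', r s = r s'} ->
    \forall y \near within `[a, b] (nbhs x), r y = r x.
  by move=> rC; apply: filterS (withinT _ _) => y yab; exact: rC.
have FF : Filter (within `[a, b] (nbhs x)) by exact _.
apply: (@near_signed_cind _ _ _ _ x FF e Y Yh Z Zh ee).
- exact: lagrangian_path_near LY xab.
- exact: lagrangian_path_near LYh xab.
- exact: lagrangian_path_near LZ xab.
- exact: lagrangian_path_near LZh xab.
- exact: (near_rk (fun s => \rank (wronskian (Y s) (Yh s)))).
- exact: (near_rk (fun s => \rank (wronskian (Z s) (Y s)))).
- exact: (near_rk (fun s => \rank (wronskian (Zh s) (Yh s)))).
- exact: (near_rk (fun s => \rank (usubmx (Z s)))).
- exact: (near_rk (fun s => \rank (usubmx (Zh s)))).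
Qed.

End OscillationSums.

(** * Adapted systems *)

Section AdaptedSystems.
Variables (R : realType) (n : nat).
Implicit Types (Y Yh : R -> 'M[R]_(n + n, n)) (e : R) (t : nat -> R).
Implicit Types (T : nat -> R -> 'M[R]_(n + n)).

(** For [e = -1] this is the negative of the sum defining the dual number, whose increments are
    taken backwards. *)
Definition signed_sum e Y (p : nat) t T : int :=
  \sum_(k < p) ((signed_cind e (Y (t k.+1)) (T k (t k.+1) *m Emx))%:Z
                - (signed_cind e (Y (t k)) (T k (t k) *m Emx))%:Z).

Lemma increment_sum_cut (g : nat -> R -> int) p t c :
  \sum_(k < p.+1) (g k (t k.+1) - g k (t k)) = g 0%N c - g 0%N (t 0%N) +
  \sum_(k < p.+1) (g k (t k.+1) - g k (if k : nat is 0 then c else t k)).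
Proof.
rewrite big_ord_recl [in RHS]big_ord_recl /=.
by move: (\sum_i _) => u; rewrite [RHS]addrC addrA; lia.
Qed.

Lemma adapted_node_le (a b : R) Y p t T k : adapted_system a b Y p t T ->
  (k <= p)%N -> a <= t k <= b.
Proof.
move=> [ta tb ad].
have inc i j : (i <= j)%N -> (j <= p)%N -> t i <= t j.
  elim: j => [|j IH]; first by rewrite leqn0 => /eqP ->.
  rewrite leq_eqVlt => /orP[/eqP -> //|]; rewrite ltnS => ij jp.
  by apply: le_trans (IH ij (ltnW jp)) _; have [/ltW] := ad j jp.
by move=> kp; rewrite -ta -tb !inc.
Qed.

(** The piece from [a] to [c] is split off the front. If [c] is the first node, one subinterval
    disappears and the system is shifted; otherwise the initial node just moves to [c]. *)
Lemma adapted_cut e (a b c : R) Y p t T : adapted_system a b Y p.+1 t T ->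
    a < c -> c <= t 1%N ->
  exists p' t', let T' := if c == t 1%N then T \o S else T in
    [/\ adapted_system c b Y p' t' T', (p' <= p.+1)%N,
        c = t 1%N -> p' = p &
        signed_sum e Y p.+1 t T =
        (signed_cind e (Y c) (T 0 c *m Emx))%:Z
        - (signed_cind e (Y a) (T 0 a *m Emx))%:Z + signed_sum e Y p' t' T'].
Proof.
move=> [ta tb ad] ac; rewrite le_eqVlt => /orP[/eqP ->|ct].
  rewrite eqxx; exists p, (t \o S); split; [|exact: leqnSn|by []|].
    by split; [by []|exact: tb|by move=> k kp; exact: (ad k.+1)].
  by rewrite /signed_sum big_ord_recl ta.
rewrite lt_eqF //; exists p.+1, (fun k => if k is 0 then c else t k).
split; [|exact: leqnn|by move=> ctE; rewrite ctE ltxx in ct|]; last first.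
  rewrite -{1 2}ta.
  exact: (increment_sum_cut (fun k s => (signed_cind e (Y s) (T k s *m Emx))%:Z)).
split; [by []|exact: tb|] => -[_|k kp]; last exact: (ad k.+1).
have [_ cT sT r1 r2] := ad 0 isT.
have sub s : s \in `[c, t 1%N] -> s \in `[t 0%N, t 1%N].
  by rewrite !in_itv /= => /andP[cs ->]; rewrite ta (le_trans (ltW ac)).
split=> //.
- by apply: continuous_subspaceW cT => s /= /sub.
- by move=> s /sub; exact: sT.
- by move=> s s' /sub ? /sub ?; exact: r1.
- by move=> s s' /sub ? /sub ?; exact: r2.
Qed.

Lemma adapted_head (a b c : R) Y p t T : adapted_system a b Y p.+1 t T ->
    c <= t 1%N ->
  let Z s := T 0 s *m Emx in
  [/\ lagrangian_path a c Z,
      {in `[a, c] &, forall s s', \rank (wronskian (Z s) (Y s)) =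
                                  \rank (wronskian (Z s') (Y s'))} &
      {in `[a, c] &, forall s s', \rank (usubmx (Z s)) = \rank (usubmx (Z s'))}].
Proof.
move=> [ta tb ad] ct Z; have [_ cT sT r1 r2] := ad 0 isT.
have sub s : s \in `[a, c] -> s \in `[t 0%N, t 1%N].
  by rewrite !in_itv /= ta => /andP[-> sc]; rewrite (le_trans sc).
split.
- rewrite /Z; apply: (@lagrangian_path_sub _ _ (t 0%N) (t 1%N)) => //.
    by rewrite ta.
  by apply: path_mul => //; exact: lagrangian_Emx.
- by move=> s s' /sub ? /sub ?; exact: r1.
- by move=> s s' /sub ? /sub ?; exact: r2.
Qed.

(** Two systems on the same interval are therefore both empty or both nonempty, which the
    simultaneous induction below relies on. *)
Lemma adapted0 (a b : R) Y p t T : adapted_system a b Y p t T ->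
  (a < b) = (0 < p)%N.
Proof.
case: p => [[-> -> _]|p ad]; first by rewrite ltxx.
have [/= ta tb /(_ 0 isT)[t01 _ _ _ _]] := ad.
by have /andP[_ /(lt_le_trans _)] := adapted_node_le ad (ltn0Sn p : 1 <= p.+1)%N;
  apply; rewrite -ta.
Qed.

(** Induction on the total number of subintervals of the two systems. Both are cut at the smaller of
    their first nodes [c]: up to [c] each has a single matrix function, so [signed_cind_interval]
    applies, and from [c] on at least one system has become shorter. *)
Lemma signed_sum_compare e (a b : R) Y Yh p t T p' t' T' : e * e = 1 ->
    lagrangian_path a b Y -> lagrangian_path a b Yh ->
    {in `[a, b] &, forall s s', \rank (wronskian (Y s) (Yh s)) =
                                \rank (wronskian (Y s') (Yh s'))} ->
    adapted_system a b Y p t T -> adapted_system a b Yh p' t' T' ->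
  signed_sum e Y p t T - signed_sum e Yh p' t' T' =
  (signed_cind e (Y b) (Yh b))%:Z - (signed_cind e (Y a) (Yh a))%:Z.
Proof.
move=> ee; have [N] := ubnP (p + p'); elim: N a p t T p' t' T' => // N IH.
move=> a p t T p' t' T' pN LY LYh rW ad ad'.
have p0 : (0 < p)%N = (0 < p')%N by rewrite -(adapted0 ad) -(adapted0 ad').
case: p => [|p] in pN ad p0 *.
  case: p' => [|//] in pN ad' p0 *; have [ta tb _] := ad.
  have ab : a = b by rewrite -ta tb.
  have s0 W u U : signed_sum e W 0 u U = 0 by exact: big_ord0.
  by rewrite (s0 Y) (s0 Yh) ab; exact: etrans (subrr _) (esym (subrr _)).
case: p' => [//|p'] in pN ad' p0 *; clear p0.
have [ta tb /(_ 0 isT)[t01 _ _ _ _]] := ad.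
have [ta' tb' /(_ 0 isT)[t01' _ _ _ _]] := ad'.
pose c := Num.min (t 1%N) (t' 1%N).
have ac : a < c by rewrite lt_min -{1}ta -ta' t01 t01'.
have ct : c <= t 1%N by rewrite ge_min lexx.
have ct' : c <= t' 1%N by rewrite ge_min lexx orbT.
have cb : c <= b.
  by apply: (le_trans ct); have /andP[] := adapted_node_le ad (ltn0Sn p : 1 <= p.+1)%N.
have [q [u [adq qp qE ->]]] := adapted_cut e ad ac ct.
have [q' [u' [adq' qp' qE' ->]]] := adapted_cut e ad' ac ct'.
have lt_q : (q + q' < N)%N.
  have [cE|cE] : c = t 1%N \/ c = t' 1%N by rewrite /c minEle; case: ifP; [left|right].
    by rewrite qE //; move: pN qp'; clear; lia.
  by rewrite qE' //; move: pN qp; clear; lia.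
have sub1 s : s \in `[a, c] -> s \in `[a, b].
  by rewrite !in_itv /= => /andP[-> sc]; rewrite (le_trans sc).
have sub2 s : s \in `[c, b] -> s \in `[a, b].
  by rewrite !in_itv /= => /andP[cs ->]; rewrite (le_trans (ltW ac)).
have rW2 : {in `[c, b] &, forall s s', \rank (wronskian (Y s) (Yh s)) =
                                \rank (wronskian (Y s') (Yh s'))}.
  by move=> s s' /sub2 ? /sub2 ?; exact: rW.
have LY2 := lagrangian_path_sub (ltW ac) (lexx b) LY.
have LYh2 := lagrangian_path_sub (ltW ac) (lexx b) LYh.
have tail := IH _ _ _ _ _ _ _ lt_q LY2 LYh2 rW2 adq adq'.
have [LZ r1 r2] := adapted_head ad ct.
have [LZh r1' r2'] := adapted_head ad' ct'.
have rW1 : {in `[a, c] &, forall s s', \rank (wronskian (Y s) (Yh s)) =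
                                \rank (wronskian (Y s') (Yh s'))}.
  by move=> s s' /sub1 ? /sub1 ?; exact: rW.
have LY1 := lagrangian_path_sub (lexx a) cb LY.
have LYh1 := lagrangian_path_sub (lexx a) cb LYh.
have head := signed_cind_interval ee (ltW ac) LY1 LYh1 LZ LZh rW1 r1 r1' r2 r2'.
have comb (x1 x2 y1 y2 z1 z2 w s s' : int) : x1 - y1 - z1 = x2 - y2 - z2 ->
    s - s' = w - z2 -> x2 - x1 + s - (y2 - y1 + s') = w - z1.
  by clear; lia.
exact: comb head tail.
Qed.

Lemma signed_cind_refl e (Y : 'M[R]_(n + n, n)) : e * e = 1 -> lagrangian_plane Y ->
  signed_cind e Y Y = 0%N.
Proof.
move=> ee LY; have [P|lam uY] := @exists_frame_unit _ _ [:: Y].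
  by rewrite inE => /eqP ->.
have {}uY : frame lam Y \in unitmx by apply: uY; rewrite inE eqxx.
have /eqP := signed_cind_slope ee LY LY uY uY.
rewrite eqn_add2r subrr scaler0 => /eqP ->.
exact: ind0.
Qed.

(** The path is compared with itself: its Wronskian with itself is zero, and so is its index
    relative to itself. *)
Lemma signed_sum_unique e (a b : R) Y p t T p' t' T' : e * e = 1 ->
    lagrangian_path a b Y ->
    adapted_system a b Y p t T -> adapted_system a b Y p' t' T' ->
  signed_sum e Y p t T = signed_sum e Y p' t' T'.
Proof.
move=> ee LY ad ad'; apply/eqP; rewrite -subr_eq0.
have ab : a <= b.
  by have /andP[] := adapted_node_le ad (leqnn p); case: ad => _ -> _.
have [_ LYs] := LY.
rewrite (signed_sum_compare ee LY LY _ ad ad').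
  by rewrite !signed_cind_refl //; apply: LYs; rewrite in_itv /= lexx ?ab.
move=> s s' /LYs [+ _] /LYs [+ _].
by rewrite -/(wronskian (Y s) (Y s)) -/(wronskian (Y s') (Y s')) => -> ->.
Qed.

(** A constant symplectic matrix sending [E] to [(I; lam I)]. As a local system it has an upper
    block of full rank and the frame of [Y] as Wronskian. *)
Definition line_mx (lam : R) : 'M[R]_(n + n) :=
  block_mx 0 1%:M (- 1%:M) lam%:M.

Lemma line_mx_symplectic lam : symplectic (line_mx lam).
Proof.
rewrite /symplectic /line_mx /Jmx tr_block_mx !mulmx_block.
rewrite !trmx0 !trmxN !trmx1 tr_scalar_mx.
rewrite !(mul0mx, mulmx0, mulmx1, mul1mx, addr0, add0r, mulNmx, mulmxN).
by rewrite !opprK addNr oppr0.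
Qed.

Lemma line_mxE lam : line_mx lam *m Emx = col_mx 1%:M lam%:M.
Proof. by rewrite mul_block_col !mulmx0 !add0r !mulmx1. Qed.

Lemma wronskian_line lam (Y : 'M[R]_(n + n, n)) :
  wronskian (line_mx lam *m Emx) Y = frame lam Y.
Proof.
rewrite line_mxE wronskianE col_mxKu col_mxKd trmx1 tr_scalar_mx mul1mx.
by rewrite mul_scalar_mx.
Qed.

Lemma adapted_extend (a s v lam : R) Y p t T : adapted_system a s Y p t T ->
    s < v -> (forall y, y \in `[s, v] -> frame lam (Y y) \in unitmx) ->
  adapted_system a v Y p.+1 (fun k => if (k <= p)%N then t k else v)
    (fun k => if (k < p)%N then T k else fun=> line_mx lam).
Proof.
move=> [ta ts ad] sv uY; split=> [//||k].
  by rewrite ltnn.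
rewrite ltnS => kp'; have [->|kp] : k = p \/ (k < p)%N.
    by move: kp'; rewrite leq_eqVlt => /orP[/eqP|]; [left|right].
  rewrite leqnn !ltnn ts; split=> //.
  - by apply: continuous_subspaceT => y; exact: cst_continuous.
  - by move=> y _; exact: line_mx_symplectic.
  - by move=> y y' ys ys'; rewrite !wronskian_line !mxrank_unit ?uY.
by rewrite kp' kp; exact: ad.
Qed.

(** Near each point one [lam] keeps the frame of [Y] invertible, so a constant [line_mx] is adapted
    there; these pieces are appended one after another. *)
Lemma adapted_exists (a b : R) Y : a <= b -> lagrangian_path a b Y ->
  exists p t T, adapted_system a b Y p t T.
Proof.
move=> ab LY.
(* Phrased as an implication between initial segments, the relation is transitive at once; it is
   started from the empty system on the degenerate interval at [a]. *)
pose extends s v := (exists p t T, adapted_system a s Y p t T) ->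
  exists p t T, adapted_system a v Y p t T.
suff : extends a b by apply; exists 0, (fun=> a), (fun _ _ => 1%:M); split.
apply: (@interval_induction R a b extends ab) => [s u v _ _ _ _ su uv /su /uv //|x xab].
have [LYx _ _] := lagrangian_path_near LY xab.
have [P|lam uY] := @exists_frame_unit _ _ [:: Y x]; first by rewrite inE => /eqP ->.
have {}uY : frame lam (Y x) \in unitmx by apply: uY; rewrite inE eqxx.
have [e e0 eY] := near_within_itv (near_frame _ (lagrangian_path_near LY xab) uY).
exists e => // s v as_ sx xv vb xs vx [p [t [T ad]]].
have := le_trans sx xv; rewrite le_eqVlt => /orP[/eqP <-|sv]; first by exists p, t, T.
eexists _, _, _; apply: (adapted_extend ad sv (lam := lam)) => y.
rewrite in_itv /= => /andP[sy yv]; apply: eY.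
  by rewrite in_itv /= (le_trans as_) // (le_trans yv).
by rewrite (lt_le_trans xs) // (le_lt_trans yv).
Qed.

End AdaptedSystems.

(** * Oscillation numbers and special values of the index *)

Section OscillationNumbers.
Variables (R : realType) (n : nat).
Implicit Types (Y Yh : R -> 'M[R]_(n + n, n)) (C D : 'M[R]_(n + n, n)) (a b : R).

Lemma signed_cind1 C D : signed_cind 1 C D = cind C D.
Proof. by rewrite /signed_cind scale1r. Qed.

Lemma signed_cindN1 C D : signed_cind (-1) C D = dual_cind C D.
Proof. by rewrite /signed_cind scaleN1r. Qed.

Lemma osc_sumE Y p t T : osc_sum Y p t T = signed_sum 1 Y p t T.
Proof. by apply: eq_bigr => k _; rewrite !signed_cind1. Qed.

Lemma dual_osc_sumE Y p t T : dual_osc_sum Y p t T = - signed_sum (-1) Y p t T.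
Proof.
rewrite /signed_sum -sumrN; apply: eq_bigr => k _.
by rewrite !signed_cindN1 opprB.
Qed.

Lemma mulN1N1 : (-1 : R) * -1 = 1. Proof. by rewrite mulrNN mulr1. Qed.

Lemma osc_adapted a b Y p t T : lagrangian_path a b Y ->
  adapted_system a b Y p t T -> osc Y a b = signed_sum 1 Y p t T.
Proof.
move=> LY ad; rewrite /osc; case: xgetP => [z _ [q [u [U [adq ->]]]]|no].
  by rewrite osc_sumE; apply: signed_sum_unique LY adq ad; exact: mulr1.
by case: (no (osc_sum Y p t T)); exists p, t, T.
Qed.

Lemma dual_osc_adapted a b Y p t T : lagrangian_path a b Y ->
  adapted_system a b Y p t T -> dual_osc Y a b = - signed_sum (-1) Y p t T.
Proof.
move=> LY ad; rewrite /dual_osc; case: xgetP => [z _ [q [u [U [adq ->]]]]|no].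
  rewrite dual_osc_sumE; congr (- _).
  by apply: signed_sum_unique LY adq ad; exact: mulN1N1.
by case: (no (dual_osc_sum Y p t T)); exists p, t, T.
Qed.

Lemma osc_compare a b Y Yh : a <= b ->
    lagrangian_path a b Y -> lagrangian_path a b Yh ->
    {in `[a, b] &, forall s s', \rank (wronskian (Y s) (Yh s)) =
                                \rank (wronskian (Y s') (Yh s'))} ->
  osc Y a b - osc Yh a b = (cind (Y b) (Yh b))%:Z - (cind (Y a) (Yh a))%:Z /\
  dual_osc Y a b - dual_osc Yh a b =
    (dual_cind (Y a) (Yh a))%:Z - (dual_cind (Y b) (Yh b))%:Z.
Proof.
move=> ab LY LYh rW.
have [p [t [T ad]]] := adapted_exists ab LY.
have [p' [t' [T' ad']]] := adapted_exists ab LYh.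
rewrite (osc_adapted LY ad) (osc_adapted LYh ad').
rewrite (dual_osc_adapted LY ad) (dual_osc_adapted LYh ad').
have c1 := signed_sum_compare (mulr1 1) LY LYh rW ad ad'.
have c2 := signed_sum_compare mulN1N1 LY LYh rW ad ad'.
rewrite !signed_cind1 in c1; rewrite !signed_cindN1 in c2; split; first exact: c1.
have opp2 (x y u v : int) : x - y = u - v -> - x - - y = v - u by clear; lia.
exact: opp2 c2.
Qed.

(** The slope formulas for the two signs are added; each index then meets the index of the opposite
    matrix, and the pair is a rank. *)
Lemma cind_add_dual C D : lagrangian_plane C -> lagrangian_plane D ->
  (cind C D + dual_cind C D + \rank (usubmx C) =
   \rank (wronskian C D) + \rank (usubmx D))%N.
Proof.
move=> LC LD; have [P|lam uf] := @exists_frame_unit _ _ [:: C; D].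
  by rewrite !inE => /orP[] /eqP ->.
have uC : frame lam C \in unitmx by apply: uf; rewrite !inE eqxx.
have uD : frame lam D \in unitmx by apply: uf; rewrite !inE eqxx orbT.
have := signed_cind_slope (mulr1 1) LC LD uC uD.
have := signed_cind_slope mulN1N1 LC LD uC uD.
rewrite signed_cind1 signed_cindN1 !scale1r !scaleN1r.
have sC := slope_sym LC uC; have sD := slope_sym LD uD.
have sCD : (slope lam C - slope lam D)^T = slope lam C - slope lam D.
  by rewrite trmxB sC sD.
have := ind_add_opp sC; have := ind_add_opp sD; have := ind_add_opp sCD.
rewrite !rank_slope // rank_slopeB //.
have arith (x y i i' j j' k k' r w r' : nat) :
    (i + i' = w)%N -> (j + j' = r')%N -> (k + k' = r)%N -> (y + k' = i' + j')%N ->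
    (x + k = i + j)%N -> (x + y + r = w + r')%N by clear; lia.
exact: arith.
Qed.

(** On each subinterval [cind_add_dual] applies at both ends. The ranks involving the adapted system
    are constant there, so only the increment of the rank of [X] survives, with a minus sign, and
    the sum telescopes. *)
Lemma osc_sub_dual a b Y : a <= b -> lagrangian_path a b Y ->
  osc Y a b - dual_osc Y a b = (\rank (usubmx (Y a)))%:Z - (\rank (usubmx (Y b)))%:Z.
Proof.
move=> ab LY; have [p [t [T ad]]] := adapted_exists ab LY.
rewrite (osc_adapted LY ad) (dual_osc_adapted LY ad) opprK.
pose f s : int := - (\rank (usubmx (Y s)))%:Z.
have -> : (\rank (usubmx (Y a)))%:Z - (\rank (usubmx (Y b)))%:Z = f b - f a.
  by rewrite /f opprK addrC.
rewrite /signed_sum -big_split /=.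
have [ta tb adk] := ad; have [_ LYs] := LY.
transitivity (\sum_(k < p) (f (t k.+1) - f (t k))); last first.
  by rewrite -(big_mkord xpredT (fun k => f (t k.+1) - f (t k))) telescope_sumr // ta tb.
apply: eq_bigr => k _; have [tk _ sT r1 r2] := adk k (ltn_ord k).
rewrite !signed_cind1 !signed_cindN1.
have tk0 : t k \in `[t k, t k.+1] by rewrite in_itv /= lexx ltW.
have tk1 : t k.+1 \in `[t k, t k.+1] by rewrite in_itv /= lexx ltW.
have := r1 _ _ tk0 tk1; have := r2 _ _ tk0 tk1.
have LZ s : s \in `[t k, t k.+1] -> lagrangian_plane (T k s *m Emx).
  by move=> /sT ?; apply: symplectic_lagrangian => //; exact: lagrangian_Emx.
have LYk : lagrangian_plane (Y (t k)).
  by apply: LYs; rewrite in_itv /=; apply: adapted_node_le ad (ltnW _).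
have LYk1 : lagrangian_plane (Y (t k.+1)).
  by apply: LYs; rewrite in_itv /=; apply: adapted_node_le ad _.
have rkT (A B : 'M[R]_(n + n, n)) : \rank (wronskian A B) = \rank (wronskian B A).
  by rewrite -mxrank_tr tr_wronskian mxrank_opp.
have := cind_add_dual LYk (LZ _ tk0); have := cind_add_dual LYk1 (LZ _ tk1).
rewrite ![\rank (wronskian (Y _) _)]rkT /f.
move: (T k (t k) *m Emx) (T k (t k.+1) *m Emx) (Y (t k)) (Y (t k.+1)) => Z0 Z1 Y0 Y1.
move: (cind Y0 Z0) (dual_cind Y0 Z0) (cind Y1 Z1) (dual_cind Y1 Z1) => c0 d0 c1 d1.
move: (\rank (wronskian Z0 Y0)) (\rank (wronskian Z1 Y1)) => w0 w1.
move: (\rank (usubmx Z0)) (\rank (usubmx Z1)) => z0 z1.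
move: (\rank (usubmx Y0)) (\rank (usubmx Y1)) => y0 y1.
by clear; lia.
Qed.

(** The slope depends only on the column space, hence so does the index. This permits normalizing
    [X(a)] or [X(b)] to the identity at the end. *)
Lemma signed_cind_mulr e C D (G : 'M[R]_n) : e * e = 1 -> G \in unitmx ->
    lagrangian_plane C -> lagrangian_plane D ->
  lagrangian_plane (C *m G) /\ signed_cind e (C *m G) D = signed_cind e C D.
Proof.
move=> ee uG LC LD.
have LCG : lagrangian_plane (C *m G).
  have [CC rC] := LC; split; last by rewrite mxrankMfree ?row_free_unit.
  by rewrite trmx_mul !mulmxA -(mulmxA G^T) -(mulmxA G^T) CC mulmx0 mul0mx.
have [P|lam uf] := @exists_frame_unit _ _ [:: C; D].
  by rewrite !inE => /orP[] /eqP ->.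
have uC : frame lam C \in unitmx by apply: uf; rewrite !inE eqxx.
have uD : frame lam D \in unitmx by apply: uf; rewrite !inE eqxx orbT.
have fE : frame lam (C *m G) = frame lam C *m G.
  by rewrite /frame -mul_dsub_mx -mul_usub_mx mulmxBl -scalemxAl.
have uCG : frame lam (C *m G) \in unitmx by rewrite fE unitmx_mul uC.
have sE : slope lam (C *m G) = slope lam C.
  apply: (can_inj (mulmxK uCG)); rewrite slopeK // fE mulmxA slopeK //.
  by rewrite -mul_usub_mx.
split; first exact: LCG.
have E1 := signed_cind_slope ee LCG LD uCG uD; rewrite sE in E1.
have E2 := signed_cind_slope ee LC LD uC uD.
have cancel (p q r w : nat) : (p + r = w -> q + r = w -> p = q)%N by clear; lia.
exact: cancel E1 E2.
Qed.

(** The plane [E] has slope zero for every [lam], which makes its indices against any plane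
    explicit. *)
Lemma frame_slope_Emx lam :
  frame lam (Emx : 'M[R]_(n + n, n)) \in unitmx /\
  slope lam (Emx : 'M[R]_(n + n, n)) = 0.
Proof.
split; last by rewrite /slope /Emx col_mxKu mul0mx.
by rewrite /frame /Emx col_mxKu col_mxKd scaler0 subr0 unitmx1.
Qed.

Lemma signed_cind_Emx_r e C : e * e = 1 -> lagrangian_plane C ->
  signed_cind e C Emx = 0%N.
Proof.
move=> ee LC; have [P|lam uC] := @exists_frame_unit _ _ [:: C].
  by rewrite inE => /eqP ->.
have {}uC : frame lam C \in unitmx by apply: uC; rewrite inE eqxx.
have [uE s0] := frame_slope_Emx lam.
have /eqP := signed_cind_slope ee LC (lagrangian_Emx R n) uC uE.
by rewrite s0 subr0 scaler0 ind0 addnC eqn_add2l => /eqP.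
Qed.

Lemma signed_cind_Emx_l e C : e * e = 1 -> lagrangian_plane C ->
  signed_cind e Emx C = \rank (usubmx C).
Proof.
move=> ee LC; have [P|lam uC] := @exists_frame_unit _ _ [:: C].
  by rewrite inE => /eqP ->.
have {}uC : frame lam C \in unitmx by apply: uC; rewrite inE eqxx.
have [uE s0] := frame_slope_Emx lam.
have := signed_cind_slope ee (lagrangian_Emx R n) LC uE uC.
rewrite s0 sub0r scaler0 ind0 addn0 => ->.
have e0 : e != 0 by apply: contra_eq_neq ee => ->; rewrite mul0r eq_sym oner_neq0.
rewrite scalerN addnC ind_add_opp ?mxrank_scale_nz ?rank_slope //.
by rewrite trmxZ slope_sym.
Qed.

End OscillationNumbers.

(** * Prescribed indices *)

Section PrescribedIndices.
Variables (R : realType) (n : nat).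

(** The one-dimensional case: [M] and [K] tell whether this coordinate contributes one to the index
    and to the dual index. The last two clauses keep [a] away from [b] and from zero. *)
Lemma scalar_prescribed_index (b : R) (M K : bool) : exists a : R,
  [/\ (((a - b < 0)%R + (b < 0)%R = ((b != 0)%R && M) + (a < 0)%R)%N),
      (((- (a - b) < 0)%R + (- b < 0)%R = ((b != 0)%R && K) + (- a < 0)%R)%N),
      (b != 0 -> M || K) -> a - b != 0 &
      (b != 0 -> ~~ (M && K)) -> a != 0].
Proof.
have [->|b0] := eqVneq b 0.
  by exists 1; rewrite /= subr0 oppr0 ltxx; split; rewrite ?addn0 ?oner_neq0.
(* Both contributions require [a = 0], none gives [a = b]; otherwise [a] has the sign of [b] and
   lies below [b] for [M] alone, above [b] for [K] alone. *)
pose a : R := if M then if K then 0 else if 0 < b then b / 2 else b + b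
              else if K then if 0 < b then b + b else b / 2 else b.
exists a; rewrite /a {a}.
case: M; case: K => /=; case: (ltgtP b 0) b0 => //= b0 _; split.
all: try by move=> /(_ isT).
all: try by move=> _; apply/eqP => ?; lra.
all: do 3?[case: (ltP _ (0 : R)) => ?].
all: try done.
all: try by exfalso; lra.
Qed.

(** In an orthonormal eigenbasis of [B] the problem splits into scalar ones; what remains is to
    distribute [m] and [k] contributions over the nonzero eigenvalues. *)
Lemma exists_prescribed_index (B : 'M[R]_n) (m k : nat) : B^T = B ->
    (m <= \rank B)%N -> (k <= \rank B)%N ->
  exists A : 'M[R]_n, [/\ A^T = A,
    (ind (A - B) + ind B = m + ind A)%N,
    (ind (- (A - B)) + ind (- B) = k + ind (- A))%N,
    (\rank B <= m + k)%N -> A - B \in unitmx &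
    (m + k <= \rank B)%N -> A \in unitmx].
Proof.
move=> /sym_orthogonal_diag [ O [b [OO ->]]].
have OtO : O^T *m O = 1%:M by apply: mulmx1C.
have [uO _] := mulmx1_unit OO.
have uOt : O^T \in unitmx by rewrite unitmx_tr.
have -> : \rank (O^T *m diag_mx b *m O) = #|[pred i | b 0 i != 0]|.
  rewrite -rank_diag_mx; apply: mxrank_unit_congr => //.
set S := [pred i | _] => mS kS.
pose s := enum S.
have sS : size s = #|S| by rewrite -cardE.
have s_uniq : uniq s by exact: enum_uniq.
have memS i : (i \in s) = (b 0 i != 0) by rewrite mem_enum.
have card_take j : (j <= #|S|)%N -> #|[pred i | i \in take j s]| = j.
  move=> jS; rewrite (card_uniqP (take_uniq j s_uniq)) size_takel //.
  by rewrite sS.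
(* The index takes the first [m] nonzero coordinates and the dual index the last [k]: these cover
   all of them when [m + k] is at least the rank and are disjoint when it is at most the rank. *)
pose M i := i \in take m s; pose K i := i \notin take (#|S| - k) s.
have /choice[a aP] : forall i, exists x : R,
  [/\ (((x - b 0 i < 0)%R + (b 0 i < 0)%R = ((b 0 i != 0)%R && M i) + (x < 0)%R)%N),
      (((- (x - b 0 i) < 0)%R + (- b 0 i < 0)%R =
        ((b 0 i != 0)%R && K i) + (- x < 0)%R)%N),
      (b 0 i != 0 -> M i || K i) -> x - b 0 i != 0 &
      (b 0 i != 0 -> ~~ (M i && K i)) -> x != 0].
  by move=> i; exact: scalar_prescribed_index.
pose d : 'rV[R]_n := \row_i a i.
have countE (c : 'rV[R]_n) : #|[pred i | c 0 i < 0]| = (\sum_i (c 0 i < 0)%R)%N.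
  by rewrite -sum1_card big_mkcond.
have indE (c : 'rV[R]_n) : ind (O^T *m diag_mx c *m O) = (\sum_i (c 0 i < 0)%R)%N.
  by rewrite ind_orthogonal_diag.
have opE (c : 'rV[R]_n) : - (O^T *m diag_mx c *m O) = O^T *m diag_mx (- c) *m O.
  by rewrite raddfN /= mulmxN mulNmx.
have subE : O^T *m diag_mx d *m O - O^T *m diag_mx b *m O =
    O^T *m diag_mx (d - b) *m O.
  by rewrite raddfB /= mulmxBr mulmxBl.
have unitE (c : 'rV[R]_n) : (forall i, c 0 i != 0) ->
    O^T *m diag_mx c *m O \in unitmx.
  move=> c0; rewrite !unitmx_mul uOt uO andbT unitmxE det_diag unitfE.
  by apply/prodf_neq0 => i _.
exists (O^T *m diag_mx d *m O); rewrite subE !opE !indE; split.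
- by rewrite !trmx_mul trmxK tr_diag_mx mulmxA.
- have -> : m = (\sum_i ((b 0 i != 0)%R && M i))%N.
    rewrite -{1}(card_take m mS) -sum1_card big_mkcond; apply: eq_bigr => i _.
    rewrite inE /M -memS; case: (boolP (i \in take m s)) => [/mem_take ->//|_].
    by rewrite andbF.
  rewrite -!big_split; apply: eq_bigr => i _ /=; have [h _ _ _] := aP i.
  by rewrite !mxE.
- have -> : k = (\sum_i ((b 0 i != 0)%R && K i))%N.
    pose U := [pred i | i \in take (#|S| - k) s].
    have cS : (k + #|U| = #|S|)%N by rewrite card_take ?leq_subr // subnKC.
    apply: (@addIn #|U|); rewrite cS -!sum1_card.
    rewrite [LHS]big_mkcond [X in (_ + X)%N]big_mkcond -big_split /=.
    apply: eq_bigr => i _; rewrite !inE /K -memS.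
    by case: (boolP (i \in take _ s)) => [/mem_take -> //|_]; case: (i \in s).
  rewrite -!big_split; apply: eq_bigr => i _ /=; have [_ h _ _] := aP i.
  by rewrite !mxE.
- move=> Smk; apply: unitE => i; have [_ _ h _] := aP i; rewrite !mxE; apply: h.
  rewrite -memS => si; rewrite /M /K !in_take //.
  by move: (index i s) (#|S|) Smk => x y; clear; case: (ltnP x m); lia.
- move=> Smk; apply: unitE => i; have [_ _ _ h] := aP i; rewrite !mxE; apply: h.
  rewrite -memS => si; rewrite /M /K !in_take //.
  by move: (index i s) (#|S|) Smk => x y; clear; case: (ltnP x m); lia.
Qed.

End PrescribedIndices.

(** * Solution families and planes of given slope *)

Section Solutions.
Variables (R : realType) (n : nat).
Implicit Types (C D L : 'M[R]_(n + n, n)) (S : 'M[R]_(n + n)).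

Lemma symplectic_invmx S : symplectic S -> symplectic (invmx S).
Proof.
move=> SS; have uS := symplectic_unit SS; rewrite /symplectic -{1}SS.
by rewrite trmx_inv !mulmxA mulVmx ?unitmx_tr // mul1mx mulmxK.
Qed.

Lemma wronskian_symplectic S C D : symplectic S ->
  wronskian (S *m C) (S *m D) = wronskian C D.
Proof.
by move=> SS; rewrite /wronskian trmx_mul -[in RHS]SS !mulmxA.
Qed.

Definition slope_plane lam (A : 'M[R]_n) : 'M[R]_(n + n, n) :=
  col_mx A (1%:M + lam *: A).

Lemma frame_slope_plane lam A : frame lam (slope_plane lam A) = 1%:M.
Proof. by rewrite /frame col_mxKu col_mxKd addrK. Qed.

Lemma slope_slope_plane lam A : slope lam (slope_plane lam A) = A.
Proof. by rewrite /slope frame_slope_plane col_mxKu invmx1 mulmx1. Qed.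

Lemma lagrangian_slope_plane lam A : A^T = A -> lagrangian_plane (slope_plane lam A).
Proof.
move=> Asym; split.
  rewrite -/(wronskian _ _) (wronskian_frame lam) frame_slope_plane col_mxKu.
  by rewrite Asym trmx1 mul1mx mulmx1 subrr.
apply/eqP; rewrite eqn_leq rank_leq_col /= -{1}(mxrank1 R n).
rewrite -(frame_slope_plane lam A).
(* The frame is the identity and a left multiple of the plane, so the plane has full rank. *)
have -> : frame lam (slope_plane lam A) = row_mx (- lam%:M) 1%:M *m slope_plane lam A.
  rewrite -[X in _ *m X]vsubmxK mul_row_col mulNmx !mul_scalar_mx.
  by rewrite scale1r addrC.
exact: mxrankM_maxr.
Qed.

(** A symplectic matrix preserves Wronskians, so two members of one family have a constant Wronskian
    and [osc_compare] applies. *)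
Lemma sol_compare (a b : R) (Phi : R -> 'M[R]_(n + n)) C D : a <= b ->
    {within `[a, b], continuous Phi} ->
    (forall s, s \in `[a, b] -> symplectic (Phi s)) ->
    lagrangian_plane C -> lagrangian_plane D ->
  let Y s := Phi s *m C in let Yh s := Phi s *m D in
  osc Y a b - osc Yh a b = (cind (Y b) (Yh b))%:Z - (cind (Y a) (Yh a))%:Z /\
  dual_osc Y a b - dual_osc Yh a b =
    (dual_cind (Y a) (Yh a))%:Z - (dual_cind (Y b) (Yh b))%:Z.
Proof.
move=> ab cPhi sPhi LC LD Y Yh.
apply: osc_compare => //; try exact: path_mul.
by move=> s s' /sPhi ss /sPhi ss'; rewrite !wronskian_symplectic.
Qed.

End Solutions.

(** * Realization of the prescribed oscillation numbers *)

Theorem theorem5p8 (R : realType) (n : nat) (a b : R) (hab : a <= b)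
    (Phi : R -> 'M[R]_(n + n))
    (Phi_cont : {within `[a, b], continuous Phi})
    (Phi_sympl : forall s, s \in `[a, b] -> symplectic (Phi s))
    (l r : int)
    (hl : osc (sol_at Phi a) a b <= l <= osc (sol_at Phi b) a b)
    (hr : dual_osc (sol_at Phi b) a b <= r <= dual_osc (sol_at Phi a) a b) :
  let good (Y : R -> 'M[R]_(n + n, n)) : Prop :=
    [/\ lagrangian_path a b Y, sol_family a b Phi Y,
        osc Y a b = l & dual_osc Y a b = r] in
  [/\ exists Y, good Y,
      r <= l -> exists2 Y, good Y & usubmx (Y a) = 1%:M,
      l <= r -> exists2 Y, good Y & usubmx (Y b) = 1%:M &
      l = r -> exists2 Y, good Y &
                 usubmx (Y a) \in unitmx /\ usubmx (Y b) \in unitmx].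
Proof.
move=> good.
have aab : a \in `[a, b] by rewrite in_itv /= lexx.
have bab : b \in `[a, b] by rewrite in_itv /= lexx hab.
have [Sa Sb] := (Phi_sympl a aab, Phi_sympl b bab).
have [ua ub] := (symplectic_unit Sa, symplectic_unit Sb).
have LE := lagrangian_Emx R n.
pose Ca : 'M[R]_(n + n, n) := invmx (Phi a) *m Emx.
pose F := Phi b *m Ca.
have LCa : lagrangian_plane Ca.
  by apply: symplectic_lagrangian => //; exact: symplectic_invmx.
have LF : lagrangian_plane F by exact: symplectic_lagrangian.
(* The family is parametrized by the value [L] at [b]; [Y_b] is then the case [L = E]. *)
pose sol (L : 'M[R]_(n + n, n)) (s : R) := Phi s *m (invmx (Phi b) *m L).
have solb L : sol L b = L by rewrite /sol mulKVmx.
have Lsol L : lagrangian_plane L -> lagrangian_plane (invmx (Phi b) *m L).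
  by apply: symplectic_lagrangian; exact: symplectic_invmx.
have solaE : sol_at Phi a = (fun s => Phi s *m Ca).
  by apply/funext => s; rewrite /sol_at -mulmxA.
have solbE : sol_at Phi b = sol Emx by apply/funext => s; rewrite /sol_at -mulmxA.
have Phia : Phi a *m Ca = Emx by rewrite /Ca mulKVmx.
pose Na := osc (fun s => Phi s *m Ca) a b.
pose Da := dual_osc (fun s => Phi s *m Ca) a b.
have sola_lag L : lagrangian_plane L -> lagrangian_plane (sol L a).
  by move=> /Lsol ?; exact: symplectic_lagrangian.
(* Comparison with [Y_a]: at [a] its value is [E], against which both indices vanish, so only the
   term at [b] is left. *)
have oscL L : lagrangian_plane L -> osc (sol L) a b = Na + (cind L F)%:Z /\
    dual_osc (sol L) a b = Da - (dual_cind L F)%:Z.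
  move=> LL.
  have [] := sol_compare hab Phi_cont Phi_sympl (Lsol L LL) LCa.
  rewrite -/(sol L) -/Na -/Da -/(sol L a) -/(sol L b) -/F solb Phia.
  have z1 := signed_cind_Emx_r (mulr1 1) (sola_lag L LL).
  have z2 := signed_cind_Emx_r (mulN1N1 R) (sola_lag L LL).
  rewrite signed_cind1 in z1; rewrite signed_cindN1 in z2; rewrite z1 z2.
  have arith1 (x y z : int) : x - y = z - 0%:Z -> x = y + z by clear; lia.
  have arith2 (x y z : int) : x - y = 0%:Z - z -> x = y - z by clear; lia.
  by move=> /arith1 h1 /arith2 h2; split.
(* Together with [oscL] this gives [l - r = m + k - rank], the rank being that of the upper block of
   [F]; the sign of [l - r] thus decides which transversality is available. *)
have DaE : Da = Na + (\rank (usubmx F))%:Z.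
  have := osc_sub_dual hab (path_mul Phi_cont Phi_sympl LCa).
  rewrite -/Na -/Da -/F Phia /Emx col_mxKu mxrank0.
  have arith (x y z : int) : x - y = 0%:Z - z -> y = x + z by clear; lia.
  exact: arith.
(* For [L = E] both indices equal the rank of the upper block of [F], so the bounds on [l] and [r]
   become bounds between zero and that rank. *)
have [oscb doscb] := oscL Emx LE.
have c1 : cind Emx F = \rank (usubmx F).
  by rewrite -signed_cind1 signed_cind_Emx_l ?mulr1.
have c2 : dual_cind Emx F = \rank (usubmx F).
  by rewrite -signed_cindN1 signed_cind_Emx_l ?mulN1N1.
rewrite solaE solbE oscb doscb c1 c2 -/Na -/Da in hl hr.
have arith (x y : int) (q : nat) : x <= l <= x + q%:Z -> y - q%:Z <= r <= y ->
    exists m k : nat, [/\ l = x + m%:Z, r = y - k%:Z, (m <= q)%N & (k <= q)%N].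
  by clear => h1 h2; exists `|l - x|%N, `|y - r|%N; split; lia.
have [m [k [lE rE mF kF]]] := arith _ _ _ hl hr.
have ord_lr (x : int) (q : nat) : l = x + m%:Z -> r = x + q%:Z - k%:Z ->
    (r <= l -> (q <= m + k)%N) /\ (l <= r -> (m + k <= q)%N).
  by clear => -> ->; split=> h; lia.
have [rl_mk lr_mk] := ord_lr _ _ lE (etrans rE (congr1 (fun z => z - k%:Z) DaE)).
have [P|lam uF] := @exists_frame_unit _ _ [:: F].
  by rewrite inE => /eqP ->.
have {}uF : frame lam F \in unitmx by apply: uF; rewrite inE eqxx.
have [A] := exists_prescribed_index (slope_sym LF uF)
  (leq_trans mF (eq_leq (esym (rank_slope uF))))
  (leq_trans kF (eq_leq (esym (rank_slope uF)))).
rewrite rank_slope // => -[Asym Am Ak AB_unit A_unit].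
pose L := slope_plane lam A.
have LL : lagrangian_plane L by exact: lagrangian_slope_plane.
have uL : frame lam L \in unitmx by rewrite frame_slope_plane unitmx1.
have cancel (p q w v : nat) : (p + q = w -> w = v + q -> p = v)%N by clear; lia.
have cL : cind L F = m.
  have := signed_cind_slope (mulr1 1) LL LF uL uF.
  rewrite signed_cind1 slope_slope_plane !scale1r => h.
  exact: cancel h Am.
have dL : dual_cind L F = k.
  have := signed_cind_slope (mulN1N1 R) LL LF uL uF.
  rewrite signed_cindN1 slope_slope_plane !scaleN1r => h.
  exact: cancel h Ak.
have good_sol (G : 'M[R]_n) : G \in unitmx -> good (sol (L *m G)).
  move=> uG.
  have [LLG s1] := signed_cind_mulr (mulr1 1) uG LL LF.
  have [_ s2] := signed_cind_mulr (mulN1N1 R) uG LL LF.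
  have [N1 N2] := oscL _ LLG.
  rewrite !signed_cind1 cL in s1; rewrite !signed_cindN1 dL in s2.
  split.
  - by apply: path_mul => //; exact: Lsol.
  - by exists (invmx (Phi b) *m (L *m G)); [exact: Lsol|].
  - by rewrite N1 s1 lE.
  - by rewrite N2 s2 rE.
have good_sol1 : good (sol L) by have := good_sol 1%:M (unitmx1 _ _); rewrite mulmx1.
have solM (G : 'M[R]_n) s : sol (L *m G) s = sol L s *m G by rewrite /sol !mulmxA.
have Xb : usubmx (sol L b) = A by rewrite solb col_mxKu.
have ua_unit : r <= l -> usubmx (sol L a) \in unitmx.
  move=> /rl_mk/AB_unit AB.
  have : wronskian L F \in unitmx.
    rewrite (wronskian_slope LL uL uF) slope_slope_plane !unitmx_mul uF andbT.
    by rewrite unitmx_tr uL.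
  (* The Wronskian of the solution with [Y_a] is the same at [b] and at [a]; at [a], where [Y_a]
     equals [E], it is the transpose of [X(a)]. *)
  have -> : wronskian L F = wronskian (sol L a) Emx.
    by rewrite -{1}[L]solb wronskian_symplectic // -(wronskian_symplectic _ _ Sa) Phia.
  by rewrite wronskianE /Emx col_mxKu col_mxKd mulmx0 subr0 mulmx1 unitmx_tr.
have ub_unit : l <= r -> usubmx (sol L b) \in unitmx.
  by rewrite Xb => /lr_mk/A_unit.
split.
- by exists (sol L).
- move=> /ua_unit uX; exists (sol (L *m invmx (usubmx (sol L a)))).
    by apply: good_sol; rewrite unitmx_inv.
  by rewrite solM -mul_usub_mx mulmxV.
- move=> /ub_unit uX; exists (sol (L *m invmx (usubmx (sol L b)))).
    by apply: good_sol; rewrite unitmx_inv.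
  by rewrite solM -mul_usub_mx mulmxV.
- move=> lr; exists (sol L) => //.
  by split; [apply: ua_unit|apply: ub_unit]; rewrite lr.
Qed.
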